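(* Consider the following types of structure on an augmented virtual equipment $\mathcal K$: (E) a collection of good yoneda embeddings $\mathrm y_A\colon A\to\widehat A$, one for each unital object $A$ of $\mathcal K$; (S) a good yoneda structure on the $2$-category $V(\mathcal K)$, in which a vertical morphism $f\colon A\to C$ is admissible precisely if its companion $f_*\colon A\nrightarrow C$ exists in $\mathcal K$. If $\mathcal K$ has all cocartesian tabulations then a structure of type (E) induces one of type (S). Conversely a structure of type (S) induces one of type (E) whenever $\mathcal K$ has, as well, cartesian cotabulations $[J]$ for all horizontal morphisms $J\colon A\nrightarrow B$ with $A$ unital, in such a way that the insertion $\sigma_A\colon A\to[J]$, which is the vertical source of the defining cell $\sigma\colon J\Rightarrow[J]$, admits a companion $\sigma_{A*}$.
   Context: **Augmented virtual double category** $\mathcal K$: it consists of objects; a category of vertical morphisms $f\colon A\to C$ between these objects; horizontal morphisms $J\colon A\nrightarrow B$ between objects; and cells. A cell $\phi\colon\underline J\Rightarrow\underline K$ has a horizontal source $\underline J=(J_1,\dotsc,J_n)$, a path $J_i\colon A_{i-1}\nrightarrow A_i$ of length $n\ge0$ (the empty path at $A_0$ is written $(A_0)$); a horizontal target $\underline K$, a path from $C$ to $D$ of length at most $1$ (so $\underline K=K\colon C\nrightarrow D$, or $\underline K=(C)$ with $C=D$, also written $\phi\colon\underline J\Rightarrow C$); a vertical source $f\colon A_0\to C$ and a vertical target $g\colon A_n\to D$. It is unary if $\underline K$ has length $1$, nullary if $\underline K$ has length $0$, vertical if $\underline J$ and $\underline K$ are both empty (written $\phi\colon f\Rightarrow g$),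 horizontal if $f$ and $g$ are identities. Given $n\ge1$ cells $\phi_i\colon\underline J_i\Rightarrow\underline K_i$, the vertical target of each being the vertical source of the next, and a cell $\psi\colon\underline K_1\frown\dotsb\frown\underline K_n\Rightarrow\underline L$ ($\frown$ denotes concatenation), there is a composite $\psi\circ(\phi_1,\dotsc,\phi_n)\colon\underline J_1\frown\dotsb\frown\underline J_n\Rightarrow\underline L$ whose vertical source (target) is that of $\psi$ composed with that of $\phi_1$ ($\phi_n$). There are identity cells $\mathrm{id}_J\colon J\Rightarrow J$ (horizontal) and $\mathrm{id}_f\colon f\Rightarrow f$ (vertical), with $\mathrm{id}_h\circ(\mathrm{id}_f)=\mathrm{id}_{h\circ f}$; $\mathrm{id}_A:=\mathrm{id}_{\mathrm{id}_A}$. Axioms: $\chi\circ(\psi_1\circ(\phi_{11},\dotsc,\phi_{1m_1}),\dotsc,\psi_n\circ(\phi_{n1},\dotsc,\phi_{nm_n}))=(\chi\circ(\psi_1,\dotsc,\psi_n))\circ(\phi_{11},\dotsc,\phi_{nm_n})$ whenever the left-hand side makes sense; $\mathrm{id}_C\circ(\phi)=\phi$, $\mathrm{id}_K\circ(\phi)=\phi$, $\phi\circ(\mathrm{id}_A)=\phi$, $\phi\circ(\mathrm{id}_{J_1},\dotsc,\mathrm{id}_{J_n})=\phi$ and $\psi\circ(\phi_1,\dotsc,\phi_i,\mathrm{id}_{f_i},\phi_{i+1},\dotsc,\phi_n)=\psi\circ(\phi_1,\dotsc,\phi_n)$ whenever these make sense. Notation: $h\circ\phi:=\mathrm{id}_h\circ(\phi)$,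 $\psi\circ f:=\psi\circ(\mathrm{id}_f)$; for adjacent cells $\phi\colon\underline J\Rightarrow\underline K$, $\psi\colon\underline H\Rightarrow\underline L$ with $\underline K\frown\underline L$ of length $\le1$, $\phi\odot\psi:=\mathrm{id}_{\underline K\frown\underline L}\circ(\phi,\psi)$, where $\mathrm{id}_{(C)}$ means $\mathrm{id}_C$. $V(\mathcal K)$ is the $2$-category of objects, vertical morphisms and vertical cells of $\mathcal K$, with $\odot$ as composition of $2$-cells. **Cartesian cells, restrictions, companions.** A cell $\psi\colon\underline J\Rightarrow\underline K$ with $\underline J$ of length $\le1$, vertical source $f$ and target $g$, is cartesian if every cell $\chi\colon\underline H\Rightarrow\underline K$ with vertical source $f\circ h$ and target $g\circ k$ factors uniquely as $\chi=\psi\circ\phi$ with $\phi\colon\underline H\Rightarrow\underline J$ having vertical source $h$ and target $k$. If $\underline J=J$ has length $1$ then $J$ is the restriction $\underline K(f,g)$ of $\underline K$ along $f$ and $g$ (written $C(f,g)$ if $\underline K=(C)$); it is unary if $\underline K$ has length $1$. An augmented virtual equipment is an augmented virtual double category that has all unary restrictions. The companion of $f\colon A\to C$ is $f_*:=C(f,\mathrm{id})\colon A\nrightarrow C$. **Cocartesian cells, units.** A path $(\phi_1,\dotsc,\phi_n)$ of unary cells $\phi_i\colon\underline J_i\Rightarrow K_i$, $K_i\colon C_{i-1}\nrightarrow C_i$, with successive vertical sources/targets $f_0,\dotsc,f_n$, is weakly cocartesian if every cell $\psi$ with horizontal source $\underline J_1\frown\dotsb\frown\underline J_n$, vertical source $h\circ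 f_0$ and target $k\circ f_n$ factors uniquely as $\psi'\circ(\phi_1,\dotsc,\phi_n)$ with $\psi'$ having horizontal source $(K_1,\dotsc,K_n)$, vertical source $h$ and target $k$. It is cocartesian if moreover (a) the restrictions $J'(\mathrm{id},f_0)$ and $J''(f_n,\mathrm{id})$ exist for all $J'\colon A'\nrightarrow C_0$ and $J''\colon C_n\nrightarrow A''$, and (b) for all paths $(J'_1,\dotsc,J'_p)$ ending at $C_0$ and $(J''_1,\dotsc,J''_q)$ starting at $C_n$, $p,q\ge0$, the path $(\mathrm{id}_{J'_1},\dotsc,\mathrm{id}_{J'_{p-1}},\mathrm{cart},\phi_1,\dotsc,\phi_n,\mathrm{cart},\mathrm{id}_{J''_2},\dotsc,\mathrm{id}_{J''_q})$ is weakly cocartesian, with $\mathrm{cart}$ the cartesian cells defining $J'_p(\mathrm{id},f_0)$ and $J''_1(f_n,\mathrm{id})$ (the left, resp. right, part being omitted if $p=0$, resp. $q=0$). An object $A$ is unital if there is a horizontal cocartesian cell $(A)\Rightarrow I_A$. **Tabulations and cotabulations.** A tabulation of $J\colon A\nrightarrow B$ is an object $\langle J\rangle$ with a unary cell $\pi\colon(\langle J\rangle)\Rightarrow J$, with vertical source $\pi_A$ and target $\pi_B$, such that: (1) every unary cell $\phi\colon(X)\Rightarrow J$, with vertical source $\phi_A$ and target $\phi_B$, equals $\pi\circ\phi'$ for a unique $\phi'\colon X\to\langle J\rangle$; (2) given unary cells $\phi\colon(X)\Rightarrow J$ and $\psi\colon(Y)\Rightarrow J$, a path $\underline H$ from $X$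 to $Y$ and nullary cells $\xi_A\colon\underline H\Rightarrow A$ (vertical source $\phi_A$, target $\psi_A$) and $\xi_B\colon\underline H\Rightarrow B$ (vertical source $\phi_B$, target $\psi_B$) with $\xi_A\odot\psi=\phi\odot\xi_B$, there is a unique nullary cell $\xi'\colon\underline H\Rightarrow\langle J\rangle$, with vertical source $\phi'$ and target $\psi'$, such that $\pi_A\circ\xi'=\xi_A$ and $\pi_B\circ\xi'=\xi_B$. It is cocartesian if $\pi$ is. Dually, a cotabulation of $J$ is an object $[J]$ with a nullary cell $\sigma\colon J\Rightarrow[J]$, with vertical source $\sigma_A\colon A\to[J]$ and target $\sigma_B\colon B\to[J]$, such that: (1) every nullary cell $\phi\colon J\Rightarrow X$, with vertical source $\phi_A$ and target $\phi_B$, equals $\phi'\circ\sigma$ for a unique $\phi'\colon[J]\to X$; (2) given nullary cells $\phi\colon J\Rightarrow X$ and $\psi\colon J\Rightarrow Y$, a path $\underline K$ of length $\le1$ from $X$ to $Y$ and cells $\xi_A\colon(A)\Rightarrow\underline K$ (vertical source $\phi_A$, target $\psi_A$) and $\xi_B\colon(B)\Rightarrow\underline K$ (vertical source $\phi_B$, target $\psi_B$) with $\xi_A\odot\psi=\phi\odot\xi_B$, there is a unique cell $\xi'\colon([J])\Rightarrow\underline K$, with vertical source $\phi'$ and target $\psi'$, such that $\xi'\circ\sigma_A=\xi_A$ and $\xi'\circ\sigma_B=\xi_B$. It is cartesian if $\sigma$ is. **Yoneda embeddings.** A nullary cell $\eta\colon J\Rightarrow M$, $J\colon A\nrightarrow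 B$, with vertical source $d$ and target $l$ defines $l$ as the left Kan extension of $d$ along $J$ if, for every path $\underline H$ (possibly empty) from $B$ to $B_m$ and every $k\colon B_m\to M$, each nullary cell $\phi\colon J\frown\underline H\Rightarrow M$ with vertical source $d$ and target $k$ factors uniquely as $\phi=\eta\odot\phi'$ with $\phi'\colon\underline H\Rightarrow M$ having vertical source $l$ and target $k$. A vertical morphism $f\colon A\to M$ is dense if every cartesian nullary cell $J\Rightarrow M$ with vertical source $f$ and vertical target $l$ defines $l$ as the left Kan extension of $f$ along $J$. A yoneda embedding is a dense vertical morphism $\mathrm y\colon A\to\widehat A$ such that for every $J\colon A\nrightarrow B$ there exists a cartesian cell $J\Rightarrow\widehat A$ with vertical source $\mathrm y$ and some vertical target $J^\lambda\colon B\to\widehat A$. It is good if all restrictions $\widehat A(\mathrm y,g)$ exist, $g\colon B\to\widehat A$. **Good yoneda structures (Weber)** on a $2$-category: a class of admissible morphisms forming a right ideal ($g\circ f$ is admissible whenever $g$ is); for each admissible object $A$ (one with $\mathrm{id}_A$ admissible) an admissible morphism $\mathrm y_A\colon A\to\widehat A$; and for each $f\colon A\to C$ with $A$ and $f$ admissible a morphism $C(f,1)\colon C\to\widehat A$ and a $2$-cell $\chi^f\colon\mathrm y_A\Rightarrow C(f,1)\circ f$; such that (1) each $\chi^f$ defines $f$ as an absolute left lifting of $\mathrm y_A$ along $C(f,1)$; (2) if $A$ and $f\colon A\to C$ are admissible and $\phi\colon\mathrm y_A\Rightarrow g\circ f$ defines $f$ as an absolute left lifting of $\mathrm y_A$ along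 $g$, then $\phi$ defines $g$ as the pointwise left Kan extension of $\mathrm y_A$ along $f$. Here $\psi\colon f\Rightarrow g\circ j$, with $f\colon A\to C$, $j\colon A\to B$, $g\colon B\to C$, defines $j$ as an absolute left lifting of $f$ along $g$ if for all $p\colon X\to A$, $q\colon X\to B$, every $2$-cell $f\circ p\Rightarrow g\circ q$ factors uniquely as $\psi\circ p$ followed by $g\circ\chi$ for a $2$-cell $\chi\colon j\circ p\Rightarrow q$; and $\eta\colon d\Rightarrow l\circ j$ defines $l$ as the pointwise left Kan extension of $d$ along $j\colon A\to B$ if for every $f\colon C\to B$, with comma object $j/f$ having projections $p\colon j/f\to A$, $q\colon j/f\to C$ and universal $2$-cell $\lambda\colon j\circ p\Rightarrow f\circ q$, the composite of $\eta\circ p$ and $l\circ\lambda$ defines $l\circ f$ as the left Kan extension of $d\circ p$ along $q$. *)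

(* Defs.v *)
From mathcomp Require Import ssreflect ssrfun ssrbool eqtype ssrnat seq.

Set Implicit Arguments.
Unset Strict Implicit.
Unset Printing Implicit Defensive.

(* Conventions.
   - All structures are given in "flat" form: morphisms and cells live in plain
     types and carry their (co)domains as values.  In this way the strict
     equations between vertical morphisms and between concatenated paths never
     force a transport on cells.
   - Partial operations (composition) are total functions whose values are
     constrained only on composable arguments; every law and every definition
     below asks for composability where it is needed.
   - [vcomp g f] and [comp psi phis] are in applicative order: f, resp. the
     cells in phis, come first.
   - A horizontal path is the sequence of its morphisms.  The empty path at an
     object A is [::]; A itself is recorded by the vertical morphisms that bound
     the cell under consideration. *)

Record avdc_data := AVDCData {
  ob : Type;
  vert : Type;
  vdom : vert -> ob;
  vcod : vert -> ob;
  vid : ob -> vert;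
  vcomp : vert -> vert -> vert;
  hor : Type;
  hdom : hor -> ob;
  hcod : hor -> ob;
  cell : Type;
  hsrc : cell -> seq hor;
  htgt : cell -> seq hor;
  vsrc : cell -> vert;
  vtgt : cell -> vert;
  idh : hor -> cell;
  idv : vert -> cell;
  comp : cell -> seq cell -> cell }.

Declare Scope avdc_scope.
Delimit Scope avdc_scope with avdc.
Local Open Scope avdc_scope.
Notation "g ∘ f" := (vcomp g f) (at level 40, left associativity) : avdc_scope.

Fixpoint all_prop T (P : T -> Prop) (s : seq T) : Prop :=
  if s is x :: s' then P x /\ all_prop P s' else True.

Section Boundaries.
Variable K : avdc_data.
Implicit Types (A B : ob K) (J : seq (hor K)) (phi psi : cell K).

Fixpoint hpath A J B : Prop :=
  if J is j :: J' then hdom j = A /\ hpath (hcod j) J' B else A = B.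

Fixpoint linked phi (s : seq (cell K)) : Prop :=
  if s is phi' :: s' then vtgt phi = vsrc phi' /\ linked phi' s' else True.

(* [psi] can be composed with the path of cells [phis], of length at least 1.
   Besides the equality of the two sequences of horizontal morphisms we ask that
   the paths start at the same object, which matters if they are empty; their
   end objects then coincide as well. *)
Definition composable psi (phis : seq (cell K)) : Prop :=
  if phis is phi :: s then
    [/\ linked phi s, flatten (map (@htgt K) phis) = hsrc psi
      & vcod (vsrc phi) = vdom (vsrc psi)]
  else False.

Definition iscell phi (J L : seq (hor K)) (f g : vert K) : Prop :=
  [/\ hsrc phi = J, htgt phi = L, vsrc phi = f & vtgt phi = g].

End Boundaries.

Record avdc_laws (K : avdc_data) : Prop := AVDCLaws {
  vdom_id : forall A : ob K, vdom (vid A) = A;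
  vcod_id : forall A : ob K, vcod (vid A) = A;
  vdom_comp : forall g f : vert K, vcod f = vdom g -> vdom (g ∘ f) = vdom f;
  vcod_comp : forall g f : vert K, vcod f = vdom g -> vcod (g ∘ f) = vcod g;
  vcompA : forall h g f : vert K, vcod f = vdom g -> vcod g = vdom h ->
    h ∘ (g ∘ f) = (h ∘ g) ∘ f;
  vcomp1f : forall f : vert K, vid (vcod f) ∘ f = f;
  vcompf1 : forall f : vert K, f ∘ vid (vdom f) = f;
  hsrc_path : forall phi : cell K,
    hpath (vdom (vsrc phi)) (hsrc phi) (vdom (vtgt phi));
  htgt_path : forall phi : cell K,
    hpath (vcod (vsrc phi)) (htgt phi) (vcod (vtgt phi));
  htgt_size : forall phi : cell K, size (htgt phi) <= 1;
  idh_cell : forall J : hor K,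
    iscell (idh J) [:: J] [:: J] (vid (hdom J)) (vid (hcod J));
  idv_cell : forall f : vert K, iscell (idv f) [::] [::] f f;
  comp_cell : forall (psi : cell K) (phis : seq (cell K)), composable psi phis ->
    iscell (comp psi phis) (flatten (map (@hsrc K) phis)) (htgt psi)
           (vsrc psi ∘ vsrc (head psi phis)) (vtgt psi ∘ vtgt (last psi phis));
  (* [ps] lists the pairs (psi_i, (phi_i1, ..., phi_im_i)); the hypotheses say that
     the cells form a two-layered pasting diagram. *)
  comp_assoc : forall (chi : cell K) (ps : seq (cell K * seq (cell K))),
    all_prop (fun p => composable p.1 p.2) ps ->
    composable chi (map fst ps) ->
    composable (comp chi (map fst ps)) (flatten (map snd ps)) ->
    comp chi [seq comp p.1 p.2 | p <- ps]
      = comp (comp chi (map fst ps)) (flatten (map snd ps));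
  comp_idv : forall h f : vert K, vcod f = vdom h ->
    comp (idv h) [:: idv f] = idv (h ∘ f);
  comp_idl0 : forall phi : cell K, htgt phi = [::] ->
    comp (idv (vid (vcod (vsrc phi)))) [:: phi] = phi;
  comp_idl1 : forall (phi : cell K) (L : hor K), htgt phi = [:: L] ->
    comp (idh L) [:: phi] = phi;
  comp_idr0 : forall phi : cell K, hsrc phi = [::] ->
    comp phi [:: idv (vid (vdom (vsrc phi)))] = phi;
  comp_idr : forall phi : cell K, hsrc phi <> [::] ->
    comp phi (map (@idh K) (hsrc phi)) = phi;
  comp_idm : forall (psi : cell K) (s1 s2 : seq (cell K)) (f : vert K),
    composable psi (s1 ++ s2) -> composable psi (s1 ++ idv f :: s2) ->
    comp psi (s1 ++ idv f :: s2) = comp psi (s1 ++ s2) }.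

Record avdc := AVDC {
  avdc_of :> avdc_data;
  avdcP : avdc_laws avdc_of }.

Section Notions.
Variable K : avdc.
Implicit Types (A : ob K) (J L : hor K) (f g h k u v : vert K).
Implicit Types (phi psi chi : cell K).

(* These are the composites h ∘ phi, psi ∘ f and phi ⊙ psi. *)
Definition lwhisk h phi : cell K := comp (idv h) [:: phi].
Definition rwhisk psi f : cell K := comp psi [:: idv f].
Definition odot phi psi : cell K :=
  if htgt phi ++ htgt psi is L :: _ then comp (idh L) [:: phi; psi]
  else comp (idv (vid (vcod (vsrc phi)))) [:: phi; psi].

Definition cartesian psi : Prop :=
  size (hsrc psi) <= 1 /\
  forall chi h k,
    vcod h = vdom (vsrc psi) -> vcod k = vdom (vtgt psi) ->
    htgt chi = htgt psi -> vsrc chi = vsrc psi ∘ h -> vtgt chi = vtgt psi ∘ k ->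
    exists! phi, iscell phi (hsrc chi) (hsrc psi) h k /\ chi = comp psi [:: phi].

(* The restriction Ls(f, g) exists; for Ls = [::] this is C(f, g), with C the
   common codomain of f and g. *)
Definition has_restriction (Ls : seq (hor K)) f g : Prop :=
  exists J psi, iscell psi [:: J] Ls f g /\ cartesian psi.

Definition equipment : Prop :=
  forall L f g, vcod f = hdom L -> vcod g = hcod L -> has_restriction [:: L] f g.

Definition has_companion f : Prop := has_restriction [::] f (vid (vcod f)).

Definition unary phi : Prop := exists L, htgt phi = [:: L].

Definition weakly_cocartesian (phis : seq (cell K)) : Prop :=
  if phis is phi :: s then
    [/\ all_prop unary phis, linked phi s
      & forall psi h k,
          vcod (vsrc phi) = vdom h -> vcod (vtgt (last phi s)) = vdom k ->
          hsrc psi = flatten (map (@hsrc K) phis) ->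
          vsrc psi = h ∘ vsrc phi -> vtgt psi = k ∘ vtgt (last phi s) ->
          exists! psi',
            iscell psi' (flatten (map (@htgt K) phis)) (htgt psi) h k /\
            psi = comp psi' phis]
  else False.

(* The paths (id_{J'_1}, ..., id_{J'_{p-1}}, cart), with cart the cartesian cell
   defining J'_p(id, f), together with the empty path (p = 0). *)
Definition left_extension f (s : seq (cell K)) : Prop :=
  s = [::] \/
  exists A (Js : seq (hor K)) J R cart,
    [/\ hpath A (rcons Js J) (vcod f), iscell cart [:: R] [:: J] (vid (hdom J)) f,
        cartesian cart & s = rcons (map (@idh K) Js) cart].

(* The paths (cart, id_{J''_2}, ..., id_{J''_q}), with cart the cartesian cell
   defining J''_1(g, id), together with the empty path (q = 0). *)
Definition right_extension g (s : seq (cell K)) : Prop :=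
  s = [::] \/
  exists A (Js : seq (hor K)) J R cart,
    [/\ hpath (vcod g) (J :: Js) A, iscell cart [:: R] [:: J] g (vid (hcod J)),
        cartesian cart & s = cart :: map (@idh K) Js].

Definition cocartesian (phis : seq (cell K)) : Prop :=
  weakly_cocartesian phis /\
  if phis is phi :: s then
    let f0 := vsrc phi in let fn := vtgt (last phi s) in
    [/\ forall J, hcod J = vcod f0 -> has_restriction [:: J] (vid (hdom J)) f0,
        forall J, hdom J = vcod fn -> has_restriction [:: J] fn (vid (hcod J))
      & forall l r, left_extension f0 l -> right_extension fn r ->
          weakly_cocartesian (l ++ phis ++ r)]
  else False.

Definition unital A : Prop :=
  exists I phi, iscell phi [::] [:: I] (vid A) (vid A) /\ cocartesian [:: phi].

(* [pi] is the universal cell of a tabulation of J; the object <J> is the common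
   domain of its vertical source and target. *)
Definition tabulation J (pi : cell K) : Prop :=
  let induced phi u :=
    vcod u = vdom (vsrc pi) /\ phi = rwhisk pi u in
  [/\ hsrc pi = [::] /\ htgt pi = [:: J],
      forall phi, hsrc phi = [::] -> htgt phi = [:: J] ->
        exists! u, induced phi u
    & forall phi psi u v (Hs : seq (hor K)) xiA xiB,
        hsrc phi = [::] -> htgt phi = [:: J] -> induced phi u ->
        hsrc psi = [::] -> htgt psi = [:: J] -> induced psi v ->
        iscell xiA Hs [::] (vsrc phi) (vsrc psi) ->
        iscell xiB Hs [::] (vtgt phi) (vtgt psi) ->
        odot xiA psi = odot phi xiB ->
        exists! xi', [/\ iscell xi' Hs [::] u v,
          lwhisk (vsrc pi) xi' = xiA & lwhisk (vtgt pi) xi' = xiB]].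

(* [sigma] is the universal cell of a cotabulation of J; the object [J] is the
   common codomain of its vertical source and target. *)
Definition cotabulation J (sigma : cell K) : Prop :=
  let induced phi u :=
    vdom u = vcod (vsrc sigma) /\ phi = lwhisk u sigma in
  [/\ hsrc sigma = [:: J] /\ htgt sigma = [::],
      forall phi, hsrc phi = [:: J] -> htgt phi = [::] ->
        exists! u, induced phi u
    & forall phi psi u v (Ls : seq (hor K)) xiA xiB,
        hsrc phi = [:: J] -> htgt phi = [::] -> induced phi u ->
        hsrc psi = [:: J] -> htgt psi = [::] -> induced psi v ->
        iscell xiA [::] Ls (vsrc phi) (vsrc psi) ->
        iscell xiB [::] Ls (vtgt phi) (vtgt psi) ->
        odot xiA psi = odot phi xiB ->
        exists! xi', [/\ iscell xi' [::] Ls u v,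
          rwhisk xi' (vsrc sigma) = xiA & rwhisk xi' (vtgt sigma) = xiB]].

Definition has_cocartesian_tabulations : Prop :=
  forall J, exists pi, tabulation J pi /\ cocartesian [:: pi].

(* [eta] : J => M defines its vertical target as the left Kan extension of its
   vertical source along J. *)
Definition defines_lan (eta : cell K) : Prop :=
  [/\ exists J, hsrc eta = [:: J], htgt eta = [::]
    & forall (Hs : seq (hor K)) phi,
        hsrc phi = hsrc eta ++ Hs -> htgt phi = [::] -> vsrc phi = vsrc eta ->
        exists! phi', iscell phi' Hs [::] (vtgt eta) (vtgt phi) /\
                      phi = odot eta phi'].

Definition dense f : Prop :=
  forall J eta, hsrc eta = [:: J] -> htgt eta = [::] -> vsrc eta = f ->
    cartesian eta -> defines_lan eta.

Definition yoneda_embedding (y : vert K) : Prop :=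
  dense y /\
  forall J, hdom J = vdom y ->
    exists eta, [/\ hsrc eta = [:: J], htgt eta = [::], vsrc eta = y
                  & cartesian eta].

Definition good_yoneda_embedding (y : vert K) : Prop :=
  yoneda_embedding y /\
  forall g, vcod g = vcod y -> has_restriction [::] y g.

End Notions.

(* [hom2 a f g] says that [a] is a 2-cell f => g; elements of [cell2] that are
   related to no f and g are ignored.  [vcomp2 a b] is "a followed by b", while
   [hcomp2 b a] is in applicative order. *)
Record cat2_data := Cat2Data {
  ob2 : Type;
  mor : Type;
  dom : mor -> ob2;
  cod : mor -> ob2;
  id1 : ob2 -> mor;
  comp1 : mor -> mor -> mor;
  cell2 : Type;
  hom2 : cell2 -> mor -> mor -> Prop;
  id2 : mor -> cell2;
  vcomp2 : cell2 -> cell2 -> cell2;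
  hcomp2 : cell2 -> cell2 -> cell2 }.

Declare Scope cat2_scope.
Delimit Scope cat2_scope with cat2.
Local Open Scope cat2_scope.
Notation "g ∘ f" := (comp1 g f) (at level 40, left associativity) : cat2_scope.
Notation "g ◁ a" := (hcomp2 (id2 g) a) (at level 40) : cat2_scope.
Notation "a ▷ f" := (hcomp2 a (id2 f)) (at level 40) : cat2_scope.
Notation "a · b" := (vcomp2 a b) (at level 50, left associativity) : cat2_scope.

Record cat2_laws (C : cat2_data) : Prop := Cat2Laws {
  dom_id1 : forall A : ob2 C, dom (id1 A) = A;
  cod_id1 : forall A : ob2 C, cod (id1 A) = A;
  dom_comp1 : forall g f : mor C, cod f = dom g -> dom (g ∘ f) = dom f;
  cod_comp1 : forall g f : mor C, cod f = dom g -> cod (g ∘ f) = cod g;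
  comp1A : forall h g f : mor C, cod f = dom g -> cod g = dom h ->
    h ∘ (g ∘ f) = (h ∘ g) ∘ f;
  comp1_idl : forall f : mor C, id1 (cod f) ∘ f = f;
  comp1_idr : forall f : mor C, f ∘ id1 (dom f) = f;
  hom2_dom : forall (a : cell2 C) f g, hom2 a f g -> dom f = dom g;
  hom2_cod : forall (a : cell2 C) f g, hom2 a f g -> cod f = cod g;
  hom2_inj : forall (a : cell2 C) f g f' g',
    hom2 a f g -> hom2 a f' g' -> f = f' /\ g = g';
  id2_hom : forall f : mor C, hom2 (id2 f) f f;
  vcomp2_hom : forall (a b : cell2 C) f g h,
    hom2 a f g -> hom2 b g h -> hom2 (a · b) f h;
  vcomp2A : forall (a b c : cell2 C) f g h k,
    hom2 a f g -> hom2 b g h -> hom2 c h k -> a · (b · c) = (a · b) · c;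
  vcomp2_idl : forall (a : cell2 C) f g, hom2 a f g -> id2 f · a = a;
  vcomp2_idr : forall (a : cell2 C) f g, hom2 a f g -> a · id2 g = a;
  hcomp2_hom : forall (b a : cell2 C) h k f g,
    hom2 a f g -> hom2 b h k -> cod f = dom h -> hom2 (hcomp2 b a) (h ∘ f) (k ∘ g);
  hcomp2A : forall (c b a : cell2 C) h k h' k' f g,
    hom2 a f g -> hom2 b h k -> hom2 c h' k' -> cod f = dom h -> cod h = dom h' ->
    hcomp2 c (hcomp2 b a) = hcomp2 (hcomp2 c b) a;
  hcomp2_idl : forall (a : cell2 C) f g, hom2 a f g -> id1 (cod f) ◁ a = a;
  hcomp2_idr : forall (a : cell2 C) f g, hom2 a f g -> a ▷ id1 (dom f) = a;
  hcomp2_id2 : forall g f : mor C, cod f = dom g -> hcomp2 (id2 g) (id2 f) = id2 (g ∘ f);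
  interchange : forall (b b' a a' : cell2 C) h h' h'' f f' f'',
    hom2 a f f' -> hom2 a' f' f'' -> hom2 b h h' -> hom2 b' h' h'' ->
    cod f = dom h -> hcomp2 (b · b') (a · a') = hcomp2 b a · hcomp2 b' a' }.

Record cat2 := Cat2 {
  cat2_of :> cat2_data;
  cat2P : cat2_laws cat2_of }.

Section TwoCategorical.
Variable C : cat2.
Implicit Types (f g j l d p q u v w : mor C).

Definition absolute_left_lifting (psi : cell2 C) f j g : Prop :=
  [/\ hom2 psi f (g ∘ j), cod j = dom g
    & forall p q (a : cell2 C),
        cod p = dom f -> dom q = dom p -> cod q = cod j ->
        hom2 a (f ∘ p) (g ∘ q) ->
        exists! c, hom2 c (j ∘ p) q /\ a = (psi ▷ p) · (g ◁ c)].

(* [eta] : d => l ∘ j defines l as the left Kan extension of d along j. *)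
Definition left_kan (eta : cell2 C) d j l : Prop :=
  [/\ hom2 eta d (l ∘ j), cod j = dom l
    & forall k (a : cell2 C),
        dom k = cod j -> cod k = cod d -> hom2 a d (k ∘ j) ->
        exists! c, hom2 c l k /\ a = eta · (c ▷ j)].

(* The (strict) comma object j/f, with projections p and q and universal 2-cell
   [lam] : j ∘ p => f ∘ q. *)
Definition comma j f p q (lam : cell2 C) : Prop :=
  [/\ [/\ dom p = dom q, cod p = dom j, cod q = dom f & hom2 lam (j ∘ p) (f ∘ q)],
      forall u v (a : cell2 C),
        dom u = dom v -> cod u = dom j -> cod v = dom f -> hom2 a (j ∘ u) (f ∘ v) ->
        exists! w, [/\ cod w = dom p, p ∘ w = u, q ∘ w = v & lam ▷ w = a]
    & forall w w' (b c : cell2 C),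
        cod w = dom p -> cod w' = dom p -> dom w = dom w' ->
        hom2 b (p ∘ w) (p ∘ w') -> hom2 c (q ∘ w) (q ∘ w') ->
        (lam ▷ w) · (f ◁ c) = (j ◁ b) · (lam ▷ w') ->
        exists! e, [/\ hom2 e w w', p ◁ e = b & q ◁ e = c]].

(* That the comma objects j/f exist is part of the definition. *)
Definition pointwise_left_kan (eta : cell2 C) d j l : Prop :=
  [/\ hom2 eta d (l ∘ j), cod j = dom l
    & forall f, cod f = cod j ->
        (exists p q lam, comma j f p q lam) /\
        forall p q lam, comma j f p q lam ->
          left_kan ((eta ▷ p) · (l ◁ lam)) (d ∘ p) q (l ∘ f)].

End TwoCategorical.

(* The values of [yon] are relevant only at admissible
   objects, those of [rep] and [rep_cell] (the morphisms C(f, 1) and the 2-cells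
   chi^f) only at admissible f with admissible domain. *)
Record good_yoneda_structure (C : cat2) := GoodYonedaStructure {
  admissible : mor C -> Prop;
  admissible_ideal : forall g f : mor C,
    cod f = dom g -> admissible g -> admissible (g ∘ f);
  yon : ob2 C -> mor C;
  yon_dom : forall A, admissible (id1 A) -> dom (yon A) = A;
  yon_admissible : forall A, admissible (id1 A) -> admissible (yon A);
  rep : mor C -> mor C;
  rep_cell : mor C -> cell2 C;
  rep_dom : forall f, admissible (id1 (dom f)) -> admissible f ->
    dom (rep f) = cod f;
  rep_cod : forall f, admissible (id1 (dom f)) -> admissible f ->
    cod (rep f) = cod (yon (dom f));
  rep_hom : forall f, admissible (id1 (dom f)) -> admissible f ->
    hom2 (rep_cell f) (yon (dom f)) (rep f ∘ f);
  rep_lifting : forall f, admissible (id1 (dom f)) -> admissible f ->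
    absolute_left_lifting (rep_cell f) (yon (dom f)) f (rep f);
  yon_pointwise : forall (f g : mor C) (phi : cell2 C),
    admissible (id1 (dom f)) -> admissible f ->
    absolute_left_lifting phi (yon (dom f)) f g ->
    pointwise_left_kan phi (yon (dom f)) f g }.

Section VerticalTwoCategory.
Variable K : avdc.

Definition V_data : cat2_data := {|
  dom := @vdom K; cod := @vcod K; id1 := @vid K; comp1 := @vcomp K;
  hom2 := fun (a : cell K) f g => iscell a [::] [::] f g;
  id2 := @idv K;
  vcomp2 := @odot K;
  hcomp2 := fun b a => comp b [:: a] |}.

Let L := avdcP K.

Lemma odot_vert (a b : cell K) f g h :
  iscell a [::] [::] f g -> iscell b [::] [::] g h ->
  composable (idv (vid (vcod f))) [:: a; b] /\
  odot a b = comp (idv (vid (vcod f))) [:: a; b].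
Proof.
move=> [sa ta fa ga] [sb tb fb gb].
have [s1 t1 f1 g1] := idv_cell L (vid (vcod f)).
rewrite /odot ta tb fa /=; split=> //; split=> /=.
- by rewrite ga fb.
- by rewrite ta tb s1.
- by rewrite f1 fa (vdom_id L).
Qed.

Lemma hcomp_vert (b a : cell K) h k f g :
  iscell a [::] [::] f g -> iscell b [::] [::] h k -> vcod f = vdom h ->
  composable b [:: a].
Proof. by move=> [sa ta fa ga] [sb tb fb gb] fh; split; rewrite /= ?ta ?sb ?fa ?fb. Qed.

Lemma vert_par (a : cell K) f g :
  iscell a [::] [::] f g -> vdom f = vdom g /\ vcod f = vcod g.
Proof.
move=> [sa ta <- <-]; have := hsrc_path L a; have := htgt_path L a.
by rewrite sa ta.
Qed.

Lemma odot_hom (a b : cell K) f g h :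
  iscell a [::] [::] f g -> iscell b [::] [::] g h -> iscell (odot a b) [::] [::] f h.
Proof.
move=> ca cb; have [cab ->] := odot_vert ca cb.
have [_ cg] := vert_par ca; have [_ ch] := vert_par cb.
rewrite /iscell; case: (comp_cell L cab) => -> -> -> ->.
case: ca cb => [sa ta fa ga] [sb tb fb gb].
have [s1 t1 f1 g1] := idv_cell L (vid (vcod f)).
split; rewrite /= ?sa ?sb //.
  by rewrite f1 fa (vcomp1f L).
by rewrite g1 gb cg ch (vcomp1f L).
Qed.

Lemma hcomp_hom (b a : cell K) h k f g :
  iscell a [::] [::] f g -> iscell b [::] [::] h k -> vcod f = vdom h ->
  iscell (comp b [:: a]) [::] [::] (vcomp h f) (vcomp k g).
Proof.
move=> ca cb fh; have cba := hcomp_vert ca cb fh.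
rewrite /iscell; case: (comp_cell L cba) => -> -> -> ->.
case: ca cb => [sa ta fa ga] [sb tb fb gb].
by split; rewrite /= ?sa ?tb ?fa ?fb ?ga ?gb.
Qed.

Lemma comp_assoc1 (chi psi : cell K) phis :
  composable psi phis -> composable chi [:: psi] ->
  composable (comp chi [:: psi]) phis ->
  comp chi [:: comp psi phis] = comp (comp chi [:: psi]) phis.
Proof.
rewrite -{2 4}(cats0 phis) => h1 h2 h3.
by apply: (@comp_assoc _ L chi [:: (psi, phis)]).
Qed.

Lemma comp_assoc2 (chi p1 p2 : cell K) s1 s2 :
  composable p1 s1 -> composable p2 s2 -> composable chi [:: p1; p2] ->
  composable (comp chi [:: p1; p2]) (s1 ++ s2) ->
  comp chi [:: comp p1 s1; comp p2 s2] = comp (comp chi [:: p1; p2]) (s1 ++ s2).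
Proof.
rewrite -{2 4}(cats0 s2) => h1 h2 h3 h4.
by apply: (@comp_assoc _ L chi [:: (p1, s1); (p2, s2)]).
Qed.

Lemma V_hcomp2_idl (a : cell K) f g :
  iscell a [::] [::] f g -> comp (idv (vid (vcod f))) [:: a] = a.
Proof. by move=> [sa ta <- ga]; rewrite (comp_idl0 L ta). Qed.

Lemma V_hcomp2_idr (a : cell K) f g :
  iscell a [::] [::] f g -> comp a [:: idv (vid (vdom f))] = a.
Proof. by move=> [sa ta <- ga]; rewrite (comp_idr0 L sa). Qed.

Lemma V_laws : cat2_laws V_data.
Proof.
have idc (f : vert K) : iscell (idv f) [::] [::] f f by exact: (idv_cell L).
have comp2 (a b c : cell K) f g h k : iscell a [::] [::] f g -> iscell b [::] [::] g h ->
    iscell c [::] [::] (vid (vcod f)) k -> composable c [:: a; b].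
  move=> [sa ta fa ga] [sb tb fb gb] [sc tc fc gc].
  split=> /=; first by rewrite ga fb.
    by rewrite ta tb sc.
  by rewrite fc fa (vdom_id L).
split=> /=.
- exact: (vdom_id L).
- exact: (vcod_id L).
- exact: (vdom_comp L).
- exact: (vcod_comp L).
- exact: (vcompA L).
- exact: (vcomp1f L).
- exact: (vcompf1 L).
- by move=> a f g /vert_par[].
- by move=> a f g /vert_par[].
- by move=> a f g f' g' [_ _ <- <-] [_ _ <- <-].
- exact: idc.
- exact: odot_hom.
- move=> a b c f g h k ca cb cc; pose i := idv (vid (vcod f)).
  have [df cf] := vert_par ca; have [dg cg] := vert_par cb.
  have [_ e1] := odot_vert ca (odot_hom cb cc).
  have [k2 e2] := odot_vert cb cc.
  have [_ e3] := odot_vert (odot_hom ca cb) cc.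
  have [k4 e4] := odot_vert ca cb.
  rewrite e1 e2 e3 e4 -cf -/i.
  have hi : iscell i [::] [::] (vid (vcod f)) (vid (vcod f)) by exact: idc.
  have cii : composable i [:: i; i].
    apply: (comp2 _ _ _ _ _ _ _ hi hi); last by rewrite (vcod_id L); exact: idc.
  have eii : comp i [:: i; i] = i.
    have := @comp_idm _ L i [:: i] [::] (vid (vcod f)).
    rewrite /= -/i => -> //.
      by have := V_hcomp2_idl hi; rewrite (vcod_id L).
    by apply: (hcomp_vert hi hi); rewrite (vcod_id L) (vdom_id L).
  have cia : composable i [:: a].
    by apply: (hcomp_vert ca hi); rewrite (vdom_id L).
  have cic : composable i [:: c].
    by apply: (hcomp_vert cc hi); rewrite (vdom_id L) -cg.
  have cabc : composable i [:: a; b; c].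
    case: ca cb cc hi => [sa ta fa ga] [sb tb fb gb] [sc tc fc gc] [si ti fi gi].
    split=> /=; first by rewrite ga fb gb fc.
      by rewrite ta tb tc si.
    by rewrite fi fa (vdom_id L).
  have kbc : composable i [:: b; c] by rewrite /i cf.
  have ei (x : cell K) y z : iscell x [::] [::] y z -> vcod y = vcod f -> comp i [:: x] = x.
    by move=> cx exf; rewrite /i -exf; exact: V_hcomp2_idl cx.
  have kab : composable i [:: a; b] by [].
  have e5 : comp i [:: comp i [:: a]; comp i [:: b; c]] = comp i [:: a; b; c].
    by rewrite comp_assoc2 ?eii.
  have e6 : comp i [:: comp i [:: a; b]; comp i [:: c]] = comp i [:: a; b; c].
    by rewrite comp_assoc2 ?eii.
  by rewrite (ei _ _ _ ca) // in e5; rewrite (ei _ _ _ cc) -?cg // in e6; rewrite e5 e6.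
- move=> a f g ca; have [k e] := odot_vert (idc f) ca; rewrite e.
  have := @comp_idm _ L (idv (vid (vcod f))) [::] [:: a] f; rewrite /= => -> //.
    exact: V_hcomp2_idl ca.
  by apply: (hcomp_vert ca (idc _)); rewrite (vdom_id L).
- move=> a f g ca; have [k e] := odot_vert ca (idc g); rewrite e.
  have := @comp_idm _ L (idv (vid (vcod f))) [:: a] [::] g; rewrite /= => -> //.
    exact: V_hcomp2_idl ca.
  by apply: (hcomp_vert ca (idc _)); rewrite (vdom_id L).
- by move=> b a h k f g; exact: hcomp_hom.
- move=> c b a h k h' k' f g ca cb cc fh hh'.
  apply: comp_assoc1; [exact: hcomp_vert ca cb fh | exact: hcomp_vert cb cc hh' |].
  apply: (hcomp_vert ca (hcomp_hom cb cc hh')).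
  by rewrite (vdom_comp L).
- exact: V_hcomp2_idl.
- exact: V_hcomp2_idr.
- exact: (comp_idv L).
- move=> b b' a a' h h' h'' f f' f'' ca ca' cb cb' fh.
  have [df cf] := vert_par ca; have [dh ch] := vert_par cb.
  have fh' : vcod f' = vdom h' by rewrite -cf -dh.
  have [k1 e1] := odot_vert cb cb'.
  have [k2 e2] := odot_vert ca ca'.
  have [k3 e3] := odot_vert (hcomp_hom ca cb fh) (hcomp_hom ca' cb' fh').
  have cbb := odot_hom cb cb'.
  have kk : composable (odot b b') [:: a; a'].
    case: ca ca' cbb => [sa ta fa ga] [sb tb fb gb] [sc tc fc gc].
    split=> /=; first by rewrite ga fb.
      by rewrite ta tb sc.
    by rewrite fc fa.
  have h1 : comp (odot b b') [:: idv (vid (vcod f))] = odot b b'.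
    by rewrite fh; exact: V_hcomp2_idr cbb.
  have h2 : composable (odot b b') [:: idv (vid (vcod f))].
    by apply: (hcomp_vert (idc _) cbb); rewrite (vcod_id L).
  rewrite e2 comp_assoc1 ?h1 // e3 (vcod_comp L) // comp_assoc2 //=.
  + by rewrite -e1.
  + exact: hcomp_vert ca cb fh.
  + exact: hcomp_vert ca' cb' fh'.
  + by rewrite -e1.
Qed.

Definition V : cat2 := Cat2 V_laws.

End VerticalTwoCategory.

(* The values of [emb] are relevant only at unital objects. *)
Record yoneda_collection (K : avdc) := YonedaCollection {
  emb : ob K -> vert K;
  emb_dom : forall A, unital A -> vdom (emb A) = A;
  emb_good : forall A, unital A -> good_yoneda_embedding (emb A) }.

Record companion_yoneda_structure (K : avdc) := CompanionYonedaStructure {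
  gys :> good_yoneda_structure (V K);
  gys_admissible : forall f : vert K, admissible gys f <-> has_companion f }.

Definition has_companion_cotabulations (K : avdc) : Prop :=
  forall J : hor K, unital (hdom J) ->
    exists sigma, [/\ cotabulation J sigma, cartesian sigma
                    & has_companion (vsrc sigma)].

(* Main.v *)
(* Horizontal composition with the companion cell f_* => C turns 2-cells
   phi : y => g ∘ f into cells phi' : f_* => M, and phi defines f as an absolute
   left lifting of y along g exactly if every vertical cell factors uniquely
   through phi'.  Cocartesian tabulations upgrade this to phi' being cartesian:
   cells out of a path (J_1, ..., J_n) correspond to cells out of the shorter path
   (J_2(pi, id), J_3, ..., J_n) starting at the tabulation of J_1, where pi is the
   vertical target of its universal cell.  The comma object f/m is the tabulation of
   f_*(id, m), so by the same reduction pointwise left Kan extensions along f in V(K)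
   are left Kan extensions along all restrictions f_*(id, m).
   From (E) to (S): y_A cartesianly classifies f_*, and density of y_A applied to the
   cartesian cells f_*(id, m) => f_* => Â gives the Kan extension axiom.
   From (S) to (E): the identity of y_A is an absolute left lifting of y_A along
   id_Â, so it exhibits id_Â as a pointwise left Kan extension of y_A along y_A, which
   is density; a cartesian cotabulation sigma presents J as a restriction of the
   companion of sigma_A, on which y_A is known to have a classifying cartesian cell;
   and the restrictions Â(y_A, g) are those of the companion of y_A. *)

From mathcomp Require Import ssreflect ssrfun ssrbool eqtype ssrnat seq.
From Stdlib Require Import ClassicalEpsilon.
Require Import Defs.

Set Implicit Arguments.
Unset Strict Implicit.
Unset Printing Implicit Defensive.

Local Open Scope avdc_scope.

(** * Boundaries of composites and the calculus of [odot] *)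

Section Calculus.
Variable K : avdc.
Let L := avdcP K.
Implicit Types (A B : ob K) (f g h k l m u v : vert K).
Implicit Types (phi psi chi theta : cell K) (J : hor K) (H Js Ls : seq (hor K)).

Lemma iscell_self phi : iscell phi (hsrc phi) (htgt phi) (vsrc phi) (vtgt phi).
Proof. by []. Qed.

Lemma iscell_src phi H Ls f g : iscell phi H Ls f g -> hpath (vdom f) H (vdom g).
Proof. by move=> [<- _ <- <-]; exact: (hsrc_path L). Qed.

Lemma iscell_tgt phi H Ls f g : iscell phi H Ls f g -> hpath (vcod f) Ls (vcod g).
Proof. by move=> [_ <- <- <-]; exact: (htgt_path L). Qed.

Lemma hpath_end H A B B' : hpath A H B -> hpath A H B' -> B = B'.
Proof. by elim: H A => [|J H IH] A /=; [move=> <- <- | move=> [_ /IH E] [_ /E]]. Qed.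

Lemma idv_iscell f : iscell (idv f) [::] [::] f f.
Proof. exact: (idv_cell L). Qed.

Lemma composable1 psi phi H Js Ls f g h k :
  iscell psi Js Ls f g -> iscell phi H Js h k -> vcod h = vdom f ->
  composable psi [:: phi].
Proof. by move=> [? ? ? ?] [? ? ? ?] ?; split=> //=; rewrite ?cats0; congruence. Qed.

Lemma comp1_iscell psi phi H Js Ls f g h k :
  iscell psi Js Ls f g -> iscell phi H Js h k -> vcod h = vdom f ->
  iscell (comp psi [:: phi]) H Ls (f ∘ h) (g ∘ k).
Proof.
move=> cpsi cphi hf; have /(comp_cell L) := composable1 cpsi cphi hf.
by case: cpsi cphi => [<- <- <- <-] [<- _ <- <-] /=; rewrite cats0.
Qed.

Lemma iscell_cod psi phi H Js Ls f g h k :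
  iscell psi Js Ls f g -> iscell phi H Js h k -> vcod h = vdom f -> vcod k = vdom g.
Proof.
move=> /iscell_src pf /iscell_tgt ph hf; rewrite hf in ph; exact: hpath_end ph pf.
Qed.

(** The boundary of [comp chi [:: psi]] already makes it composable with [phis], so associativity
    asks for two side conditions instead of three. *)
Lemma compA1 chi psi phis : composable psi phis -> composable chi [:: psi] ->
  comp chi [:: comp psi phis] = comp (comp chi [:: psi]) phis.
Proof.
move=> c1 c2; apply: comp_assoc1 => //.
have [e1 _ e3 _] := comp_cell L c2.
move: c1; case: phis => [//|phi s] [l1 fl vs].
split=> //; first by rewrite e1 /= cats0.
rewrite e3 /= (vdom_comp L) //; by case: c2.
Qed.

(** Merges the identity cells of horizontal morphisms and of objects, so that unary and nullary
    cells are handled at once; [A] is read only if [Ls] is empty. *)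
Definition idc Ls A : cell K := if Ls is J :: _ then idh J else idv (vid A).

Lemma idc_iscell Ls A B : size Ls <= 1 -> hpath A Ls B ->
  iscell (idc Ls A) Ls Ls (vid A) (vid B).
Proof.
case: Ls => [_ /= <-|J [|//] _ /= [<- <-]]; first exact: idv_iscell.
exact: (idh_cell L).
Qed.

Lemma comp_idcl phi H Ls f g : iscell phi H Ls f g ->
  comp (idc Ls (vcod f)) [:: phi] = phi.
Proof.
move=> c; have := htgt_size L phi; case: c => [_ eL <- _]; rewrite eL.
case: Ls eL => [|J [|//]] eL _; first exact: (comp_idl0 L).
exact: (comp_idl1 L).
Qed.

Lemma comp_idcr phi H Ls f g : size H <= 1 -> iscell phi H Ls f g ->
  comp phi [:: idc H (vdom f)] = phi.
Proof.
move=> sH [eH _ <- _]; case: H eH sH => [|J [|//]] eH _; first exact: (comp_idr0 L).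
by have := @comp_idr _ L phi; rewrite eH; apply.
Qed.

Lemma odotE phi psi : odot phi psi =
  comp (idc (htgt phi ++ htgt psi) (vcod (vsrc phi))) [:: phi; psi].
Proof. by rewrite /odot /idc; case: (_ ++ _). Qed.

Lemma hpath_cat A B B' H1 H2 : hpath A H1 B -> hpath B H2 B' -> hpath A (H1 ++ H2) B'.
Proof.
elim: H1 A => [|J s IH] A /=; first by move=> ->.
by move=> [-> ps] pb; split=> //; apply: IH.
Qed.

Lemma composable2 psi phi1 phi2 H1 H2 Js1 Js2 Ls f g h k m :
  iscell psi (Js1 ++ Js2) Ls f g -> iscell phi1 H1 Js1 h k -> iscell phi2 H2 Js2 k m ->
  vcod h = vdom f -> composable psi [:: phi1; phi2].
Proof.
move=> [e1 e2 e3 e4] [e5 e6 e7 e8] [e9 e10 e11 e12] hf.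
by split=> /=; rewrite ?cats0; [split=> //| |]; congruence.
Qed.

Lemma comp2_iscell psi phi1 phi2 H1 H2 Js1 Js2 Ls f g h k m :
  iscell psi (Js1 ++ Js2) Ls f g -> iscell phi1 H1 Js1 h k -> iscell phi2 H2 Js2 k m ->
  vcod h = vdom f -> iscell (comp psi [:: phi1; phi2]) (H1 ++ H2) Ls (f ∘ h) (g ∘ m).
Proof.
move=> cpsi c1 c2 hf; have := comp_cell L (composable2 cpsi c1 c2 hf).
by move: cpsi c1 c2 => [_ <- <- <-] [<- _ <- _] [<- _ _ <-] /=; rewrite cats0.
Qed.

Lemma odot_idc phi psi H1 H2 Js1 Js2 f h g :
  iscell phi H1 Js1 f h -> iscell psi H2 Js2 h g -> size (Js1 ++ Js2) <= 1 ->
  iscell (idc (Js1 ++ Js2) (vcod f)) (Js1 ++ Js2) (Js1 ++ Js2) (vid (vcod f)) (vid (vcod g)).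
Proof.
move=> c1 c2 sJ; apply: idc_iscell => //.
exact: hpath_cat (iscell_tgt c1) (iscell_tgt c2).
Qed.

Lemma odot_iscell phi psi H1 H2 Js1 Js2 f h g :
  iscell phi H1 Js1 f h -> iscell psi H2 Js2 h g -> size (Js1 ++ Js2) <= 1 ->
  iscell (odot phi psi) (H1 ++ H2) (Js1 ++ Js2) f g.
Proof.
move=> c1 c2 sJ; have ci := odot_idc c1 c2 sJ.
have := comp2_iscell ci c1 c2; rewrite (vdom_id L) => /(_ erefl).
by rewrite odotE !(vcomp1f L); case: (c1) (c2) => _ -> -> _ [_ -> _ _].
Qed.

Lemma linked_cat phi1 s1 phi2 s2 : linked phi1 s1 ->
  vtgt (last phi1 s1) = vsrc phi2 -> linked phi2 s2 -> linked phi1 (s1 ++ phi2 :: s2).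
Proof.
by elim: s1 phi1 => [|phi s IH] phi1 //= [-> l1] e l2; split=> //; apply: IH.
Qed.

(** Only start objects are matched by [composable]; walking along the concatenated targets, which
    form the horizontal source of [psi], shows that the end objects agree too. *)
Lemma composable_cod psi phi s : composable psi (phi :: s) ->
  vcod (vtgt (last phi s)) = vdom (vtgt psi).
Proof.
move=> [ls fl e]; have := hsrc_path L psi; rewrite -fl -e.
elim: s phi ls {fl e} => [|phi' s IH] phi /= [].
  by have := htgt_path L phi; rewrite cats0; exact: hpath_end.
move=> e ls.
have: hpath (vcod (vsrc phi)) (htgt phi) (vcod (vsrc phi')).
  by rewrite -e; exact: htgt_path.
(* Strip the target of the first cell off the path; what remains starts where the next cell
   starts. *)
elim: (htgt phi) (vcod _) => [|J t IHt] A /=; first by move=> ->; exact: IH.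
by move=> [-> p] [_]; exact: IHt.
Qed.

(** Interchange law: both sides are the same layered pasting into an identity cell, bracketed in two
    ways. *)
Lemma comp_odot psi1 psi2 phi1 s1 phi2 s2 :
  composable psi1 (phi1 :: s1) -> composable psi2 (phi2 :: s2) ->
  vtgt psi1 = vsrc psi2 -> vtgt (last phi1 s1) = vsrc phi2 ->
  size (htgt psi1 ++ htgt psi2) <= 1 ->
  odot (comp psi1 (phi1 :: s1)) (comp psi2 (phi2 :: s2))
    = comp (odot psi1 psi2) (phi1 :: s1 ++ phi2 :: s2).
Proof.
move=> c1 c2 e e' sJ.
have d1 := iscell_self psi1; have d2 := iscell_self psi2; rewrite -e in d2.
have := odot_idc d1 d2 sJ; have := odot_iscell d1 d2 sJ; set J := _ ++ htgt psi2.
move=> co ci; have := composable2 ci d1 d2; rewrite (vdom_id L) => /(_ erefl) c12.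
have [_ E2 E3 _] := comp_cell L c1; have [_ E5 _ _] := comp_cell L c2.
rewrite !odotE E2 E3 E5 /= (vcod_comp L) -/J; last by case: c1.
apply: comp_assoc2 => //; rewrite -odotE.
case: co c1 c2 => co1 _ co3 _ [l1 f1 v1] [l2 f2 v2]; split.
- exact: linked_cat.
- by rewrite co1 -f1 -f2 map_cat flatten_cat /= catA.
- by rewrite co3.
Qed.

Lemma odot_idl phi H Ls f g : iscell phi H Ls f g -> odot (idv f) phi = phi.
Proof.
move=> c; have ci := idv_iscell f; have sL : size Ls <= 1.
  by case: (c) => _ <- _ _; exact: htgt_size.
have co := odot_idc ci c sL.
have := composable2 co ci c; have := composable1 co c; rewrite (vdom_id L).
move=> /(_ erefl) c1 /(_ erefl) c2; have := @comp_idm _ L _ [::] [:: phi] f c1 c2.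
rewrite odotE; case: (c) ci => _ -> _ _ [_ -> -> _] /= ->; exact: comp_idcl c.
Qed.

Lemma odot_idr phi H Ls f g : iscell phi H Ls f g -> odot phi (idv g) = phi.
Proof.
move=> c; have ci := idv_iscell g; have sL : size (Ls ++ [::]) <= 1.
  by case: (c) => _ <- _ _; rewrite cats0; exact: htgt_size.
have co := odot_idc c ci sL.
have := composable2 co c ci; rewrite cats0 in co; have := composable1 co c.
rewrite (vdom_id L) cats0.
move=> /(_ erefl) c1 /(_ erefl) c2; have := @comp_idm _ L _ [:: phi] [::] g c1 c2.
rewrite odotE; case: (c) ci => _ -> -> _ [_ -> _ _]; rewrite /= cats0 => ->.
exact: comp_idcl c.
Qed.

(** The identity cell hidden in [odot] is absorbed by [psi]. *)
Lemma comp_pair psi phi1 phi2 H1 H2 Js1 Js2 Ls f g h k m :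
  iscell psi (Js1 ++ Js2) Ls f g -> iscell phi1 H1 Js1 h k -> iscell phi2 H2 Js2 k m ->
  vcod h = vdom f -> size (Js1 ++ Js2) <= 1 ->
  comp psi [:: odot phi1 phi2] = comp psi [:: phi1; phi2].
Proof.
move=> cpsi c1 c2 hf sJ; have co := odot_idc c1 c2 sJ.
rewrite odotE; case: (c1) (c2) => _ -> -> _ [_ -> _ _].
have coo : composable psi [:: idc (Js1 ++ Js2) (vcod h)].
  by apply: (composable1 cpsi co); rewrite (vcod_id L).
rewrite compA1 //; first by rewrite hf (comp_idcr sJ cpsi).
by apply: (composable2 co c1 c2); rewrite (vdom_id L).
Qed.

(** Interchange applied after writing [psi] as [odot (idv f) psi]. The next three lemmas are the
    variants with the vertical identity on the other side or in the other layer. *)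
Lemma comp_odot_r psi phi1 phi2 H1 H2 Js Ls f g h k m :
  iscell psi Js Ls f g -> iscell phi1 H1 [::] h k -> iscell phi2 H2 Js k m ->
  vcod h = vdom f -> size Js <= 1 ->
  comp psi [:: odot phi1 phi2]
    = odot (comp (idv f) [:: phi1]) (comp psi [:: phi2]).
Proof.
move=> cpsi c1 c2 hf sJ; have ci := idv_iscell f.
rewrite (@comp_pair psi _ _ H1 H2 [::] Js Ls f g h k m) //.
rewrite comp_odot /= ?(odot_idl cpsi) //.
- exact: (composable1 ci c1).
- by apply: (composable1 cpsi c2); rewrite (iscell_cod ci c1 hf).
- by case: ci cpsi => _ _ _ -> [].
- by case: c1 c2 => _ _ _ -> [].
- by case: ci => _ -> _ _; exact: htgt_size.
Qed.

Lemma comp_odot_l psi phi1 phi2 H1 H2 Js Ls f g h k m :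
  iscell psi Js Ls f g -> iscell phi1 H1 Js h k -> iscell phi2 H2 [::] k m ->
  vcod h = vdom f -> size Js <= 1 ->
  comp psi [:: odot phi1 phi2]
    = odot (comp psi [:: phi1]) (comp (idv g) [:: phi2]).
Proof.
move=> cpsi c1 c2 hf sJ; have ci := idv_iscell g.
rewrite (@comp_pair psi _ _ H1 H2 Js [::] Ls f g h k m) ?cats0 //.
rewrite comp_odot /= ?(odot_idr cpsi) //.
- exact: (composable1 cpsi c1).
- by apply: (composable1 ci c2); rewrite (iscell_cod cpsi c1 hf).
- by case: ci cpsi => _ _ -> _ [].
- by case: c1 c2 => _ _ _ -> [].
- by case: ci => _ -> _ _; rewrite cats0; exact: htgt_size.
Qed.

Lemma odot_comp_r phi1 phi2 psi H Js Js1 Js2 f g h k m :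
  iscell phi1 [::] Js1 f g -> iscell phi2 Js Js2 g h -> iscell psi H Js k m ->
  vcod k = vdom f -> size (Js1 ++ Js2) <= 1 ->
  comp (odot phi1 phi2) [:: psi]
    = odot (comp phi1 [:: idv k]) (comp phi2 [:: psi]).
Proof.
move=> c1 c2 cpsi kf sJ; have ci := idv_iscell k.
have co := odot_iscell c1 c2 sJ.
have fg := iscell_src c1; rewrite /= in fg.
rewrite comp_odot /=.
- have := @comp_idm _ L (odot phi1 phi2) [::] [:: psi] k; rewrite /= => -> //.
    exact: composable1 co cpsi kf.
  exact: (@composable2 _ _ _ [::] H [::] Js _ _ _ k k m co ci cpsi kf).
- exact: (composable1 c1 ci).
- by apply: (composable1 c2 cpsi); rewrite -fg.
- by case: c1 c2 => _ _ _ -> [].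
- by case: ci cpsi => _ _ _ -> [].
- by case: c1 c2 => _ -> _ _ [_ ->].
Qed.

Lemma odot_comp_l phi1 phi2 psi H Js Js1 Js2 f g h k m :
  iscell phi1 Js Js1 f g -> iscell phi2 [::] Js2 g h -> iscell psi H Js k m ->
  vcod k = vdom f -> size (Js1 ++ Js2) <= 1 ->
  comp (odot phi1 phi2) [:: psi]
    = odot (comp phi1 [:: psi]) (comp phi2 [:: idv m]).
Proof.
move=> c1 c2 cpsi kf sJ; have ci := idv_iscell m.
have co := odot_iscell c1 c2 sJ; have mg := iscell_cod c1 cpsi kf.
rewrite comp_odot /=.
- have := @comp_idm _ L (odot phi1 phi2) [:: psi] [::] m; rewrite /= => -> //.
    by rewrite cats0 in co; exact: composable1 co cpsi kf.
  exact: (@composable2 _ _ _ H [::] Js [::] _ _ _ k m m co cpsi ci kf).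
- exact: (composable1 c1 cpsi).
- exact: (composable1 c2 ci).
- by case: c1 c2 => _ _ _ -> [].
- by case: ci cpsi => _ _ -> _ [_ _ _ ->].
- by case: c1 c2 => _ -> _ _ [_ ->].
Qed.

Lemma composable_iscell psi phi s : composable psi (phi :: s) ->
  iscell (comp psi (phi :: s)) (flatten (map (@hsrc K) (phi :: s))) (htgt psi)
    (vsrc psi ∘ vsrc phi) (vtgt psi ∘ vtgt (last phi s)).
Proof. exact: comp_cell. Qed.

(** * Cartesian cells *)

(** Here and in [cart_inj] the universal property is split into existence and uniqueness, with
    boundaries in [iscell] form; [cart_intro] reassembles it. *)
Lemma cart_ex psi chi Js H Ls f g h k :
  cartesian psi -> iscell psi Js Ls f g -> iscell chi H Ls (f ∘ h) (g ∘ k) ->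
  vcod h = vdom f -> vcod k = vdom g ->
  exists2 phi, iscell phi H Js h k & chi = comp psi [:: phi].
Proof.
move=> [_ cpsi] [e1 e2 e3 e4] [e5 e6 e7 e8] hf kg.
have [||||| phi [[cphi e] _]] := cpsi chi h k; [congruence.. |].
by exists phi => //; rewrite -e1 -e5.
Qed.

Lemma cart_inj psi phi1 phi2 Js H Ls f g h k :
  cartesian psi -> iscell psi Js Ls f g -> iscell phi1 H Js h k -> iscell phi2 H Js h k ->
  vcod h = vdom f -> comp psi [:: phi1] = comp psi [:: phi2] -> phi1 = phi2.
Proof.
move=> [_ cpsi] c c1 c2 hf e; have kg := iscell_cod c c1 hf.
have c3 := comp1_iscell c c1 hf.
case: (c) (c3) => [e1 e2 e3 e4] [e5 e6 e7 e8].
have [||||| phi [_ phiU]] := cpsi (comp psi [:: phi1]) h k; [congruence.. |].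
by rewrite -(phiU phi1) ?(phiU phi2) // e1 e5.
Qed.

Lemma cart_intro psi Js Ls f g : iscell psi Js Ls f g -> size Js <= 1 ->
  (forall chi H h k, iscell chi H Ls (f ∘ h) (g ∘ k) ->
     vcod h = vdom f -> vcod k = vdom g ->
     exists2 phi, iscell phi H Js h k & chi = comp psi [:: phi]) ->
  (forall phi1 phi2 H h k, iscell phi1 H Js h k -> iscell phi2 H Js h k ->
     vcod h = vdom f -> comp psi [:: phi1] = comp psi [:: phi2] -> phi1 = phi2) ->
  cartesian psi.
Proof.
move=> [<- <- <- <-] sJ ex inj; split=> // chi h k hf kg e1 e2 e3.
have [phi cphi e] := ex chi (hsrc chi) h k (And4 erefl e1 e2 e3) hf kg.
exists phi; split=> // phi' [cphi' e']; apply: inj cphi cphi' hf _.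
by rewrite -e -e'.
Qed.

(** Factor through [psi] first, then through [theta]. *)
Lemma cart_comp psi theta Js Js' Ls f g h k :
  cartesian psi -> iscell psi Js Ls f g -> cartesian theta -> iscell theta Js' Js h k ->
  vcod h = vdom f -> cartesian (comp psi [:: theta]).
Proof.
move=> Cpsi cpsi Ctheta ctheta hf; have kg := iscell_cod cpsi ctheta hf.
have sJ' : size Js' <= 1 by case: Ctheta => + _; case: ctheta => ->.
have cc := comp1_iscell cpsi ctheta hf.
apply: (cart_intro cc) => //.
  move=> chi H u v cchi; rewrite !(vdom_comp L) // => uh vk.
  rewrite -!(vcompA L) // in cchi.
  have [||phi cphi ->] := cart_ex Cpsi cpsi cchi; rewrite ?(vcod_comp L) //.
  have [xi cxi ->] := cart_ex Ctheta ctheta cphi uh vk.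
  exists xi => //; rewrite compA1 //; first exact: composable1 ctheta cxi uh.
  exact: composable1 cpsi ctheta hf.
move=> phi1 phi2 H u v c1 c2; rewrite !(vdom_comp L) // => uh.
have tf : composable psi [:: theta] by exact: composable1 cpsi ctheta hf.
rewrite -(compA1 (composable1 ctheta c1 uh) tf) -(compA1 (composable1 ctheta c2 uh) tf).
move/(cart_inj Cpsi cpsi (comp1_iscell ctheta c1 uh) (comp1_iscell ctheta c2 uh)).
by rewrite (vcod_comp L) // => /(_ hf); apply: cart_inj Ctheta ctheta c1 c2 uh.
Qed.

(** To factor a cell through [theta], compose it with [psi], factor the result through the
    composite, and cancel [psi] by uniqueness. *)
Lemma cart_cancel psi theta Js Js' Ls f g h k :
  cartesian psi -> iscell psi Js Ls f g -> iscell theta Js' Js h k ->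
  vcod h = vdom f -> cartesian (comp psi [:: theta]) -> cartesian theta.
Proof.
move=> Cpsi cpsi ctheta hf Cc; have kg := iscell_cod cpsi ctheta hf.
have cc := comp1_iscell cpsi ctheta hf.
have sJ' : size Js' <= 1 by case: Cc => + _; case: cc => ->.
have tf : composable psi [:: theta] by exact: composable1 cpsi ctheta hf.
apply: (cart_intro ctheta) => // [chi H u v cchi uh vk|phi1 phi2 H u v c1 c2 uh e].
  have cx : iscell (comp psi [:: chi]) H Ls ((f ∘ h) ∘ u) ((g ∘ k) ∘ v).
    rewrite -!(vcompA L) //; apply: (comp1_iscell cpsi cchi).
    by rewrite (vcod_comp L).
  have [||phi cphi e] := cart_ex Cc cc cx; rewrite ?(vdom_comp L) //.
  exists phi => //; apply: (cart_inj Cpsi cpsi cchi).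
  - exact: comp1_iscell ctheta cphi uh.
  - by rewrite (vcod_comp L).
  - by rewrite e compA1 //; exact: composable1 ctheta cphi uh.
apply: (cart_inj Cc cc c1 c2); first by rewrite (vdom_comp L).
by rewrite -(compA1 (composable1 ctheta c1 uh) tf) -(compA1 (composable1 ctheta c2 uh) tf) e.
Qed.

(** * Weakly cocartesian paths *)

Lemma wcc_ex phi s psi Ls h k :
  weakly_cocartesian (phi :: s) ->
  iscell psi (flatten (map (@hsrc K) (phi :: s))) Ls (h ∘ vsrc phi)
    (k ∘ vtgt (last phi s)) ->
  vcod (vsrc phi) = vdom h -> vcod (vtgt (last phi s)) = vdom k ->
  exists2 psi', iscell psi' (flatten (map (@htgt K) (phi :: s))) Ls h k
    & psi = comp psi' (phi :: s).
Proof.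
move=> [_ _ W] [e1 <- e3 e4] ch ck.
by have [psi' [[c e] _]] := W psi h k ch ck e1 e3 e4; exists psi'.
Qed.

(** The condition on the codomain side that the universal property asks of [k] is supplied by
    [composable_cod]. *)
Lemma wcc_inj phi s psi1 psi2 Ls h k :
  weakly_cocartesian (phi :: s) ->
  iscell psi1 (flatten (map (@htgt K) (phi :: s))) Ls h k ->
  iscell psi2 (flatten (map (@htgt K) (phi :: s))) Ls h k ->
  vcod (vsrc phi) = vdom h ->
  comp psi1 (phi :: s) = comp psi2 (phi :: s) -> psi1 = psi2.
Proof.
move=> [_ l W] c1 c2 ch e.
have co : composable psi1 (phi :: s) by case: c1 => e1 _ e3 _; split; rewrite ?e1 ?e3.
have [e1 e2 e3 e4] := composable_iscell co.
have := composable_cod co; case: (c1) e2 e3 e4 => _ -> -> -> e2 e3 e4 ck.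
have [psi' [_ U]] := W _ h k ch ck e1 e3 e4.
by rewrite -(U psi1) ?(U psi2) // e2.
Qed.

Lemma composable_wcc phi s psi Ls h k :
  weakly_cocartesian (phi :: s) ->
  iscell psi (flatten (map (@htgt K) (phi :: s))) Ls h k ->
  vcod (vsrc phi) = vdom h -> composable psi (phi :: s).
Proof. by move=> [_ l _] [e1 _ e3 _] ch; split; rewrite ?e1 ?e3. Qed.

Lemma idh_cartesian J : cartesian (idh J).
Proof.
have c := idh_cell L J; apply: (cart_intro c) => // [chi H h k|phi1 phi2 H h k].
  move=> cchi hf kg; exists chi.
    rewrite -[h](vcomp1f L) -[k](vcomp1f L) hf kg.
    by rewrite (vdom_id L) (vdom_id L).
  by rewrite (comp_idl1 L) //; case: cchi.
by move=> [_ t1 _ _] [_ t2 _ _] _; rewrite !(comp_idl1 L t1) !(comp_idl1 L t2).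
Qed.

Lemma vid_vid A : vid A ∘ vid A = vid A.
Proof. by rewrite -{1}(vcod_id L A) (vcomp1f L). Qed.

Lemma vid_compl A f : vcod f = A -> vid A ∘ f = f.
Proof. by move=> <-; exact: vcomp1f. Qed.

Lemma vid_compr A f : vdom f = A -> f ∘ vid A = f.
Proof. by move=> <-; exact: vcompf1. Qed.

(** Factoring the identity cell of [Js] through [psi] gives a right inverse; cancelling [psi] shows
    that it is a left inverse as well. *)
Lemma cartesian_inverse psi H Js A B : iscell psi H Js (vid A) (vid B) ->
  size Js <= 1 -> cartesian psi ->
  exists psi', [/\ iscell psi' Js H (vid A) (vid B), comp psi [:: psi'] = idc Js A
                 & comp psi' [:: psi] = idc H A].
Proof.
move=> c sJ C; have sH : size H <= 1 by case: C => + _; case: c => ->.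
have pJ := iscell_tgt c; have pH := iscell_src c.
rewrite !(vcod_id L) in pJ; rewrite !(vdom_id L) in pH.
have ci := idc_iscell sJ pJ; have ci' := idc_iscell sH pH.
have [AA BB] : vcod (vid A) = vdom (vid A) /\ vcod (vid B) = vdom (vid B).
  by rewrite !(vcod_id L) !(vdom_id L).
have ci2 : iscell (idc Js A) Js Js (vid A ∘ vid A) (vid B ∘ vid B) by rewrite !vid_vid.
have [psi' c' e] := cart_ex C c ci2 AA BB.
exists psi'; split=> //.
have cp := comp1_iscell c' c AA; rewrite !vid_vid in cp.
apply: (cart_inj C c cp ci' AA).
rewrite compA1; [|exact: composable1 c' c AA|exact: composable1 c c' AA].
rewrite -e; have := comp_idcl c; rewrite (vcod_id L) => ->.
by have := comp_idcr sH c; rewrite (vdom_id L) => ->.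
Qed.

(** The identity of [vid A] factors through the cocartesian cell [eta] as [eps] after [eta]. The two
    cells are inverse to each other, so composition with [eta] provides the factorizations through
    [eps]. *)
Lemma unital_has_companion A : unital A -> has_companion (vid A).
Proof.
move=> [I [eta [c [W _]]]].
have AA : vcod (vid A) = vdom (vid A) by rewrite (vcod_id L) (vdom_id L).
have [c1 c2 c3 c4] := c.
have i : iscell (idv (vid A)) (flatten (map (@hsrc K) [:: eta])) [::]
    (vid A ∘ vsrc eta) (vid A ∘ vtgt (last eta [::])).
  by rewrite /= c1 c3 c4 vid_vid; exact: idv_iscell.
have [||eps ceps e] := wcc_ex W i; rewrite /= ?c3 ?c4 //; rewrite /= c2 in ceps.
have p1 := composable1 ceps c AA; have p2 := composable1 c ceps AA.
have ci := idh_cell L I.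
have [IA IA'] : hdom I = A /\ hcod I = A.
  by have /= [-> ->] := iscell_tgt c; rewrite (vcod_id L).
rewrite IA IA' in ci.
(* Both sides agree after composition with the weakly cocartesian cell [eta]. *)
have ee : comp eta [:: eps] = idh I.
  have ce := comp1_iscell c ceps AA; rewrite !vid_vid in ce.
  apply: (wcc_inj W (h := vid A) (k := vid A) (Ls := [:: I])); rewrite /= ?c2 ?c3 //.
  rewrite -(compA1 p1 p2) -e.
  have := comp_idcr (H := [::]) isT c; rewrite (vdom_id L) => /= ->.
  by rewrite (comp_idl1 L c2).
exists I, eps; rewrite (vcod_id L); split=> //.
apply: (cart_intro ceps) => // [chi H h k cchi hA kA|phi1 phi2 H h k d1 d2 hA e'].
  have d := comp1_iscell c cchi; rewrite (vcod_comp L) // in d; have {}d := d AA.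
  have q : composable eta [:: chi].
    by apply: (composable1 c cchi); rewrite (vcod_comp L).
  exists (comp eta [:: chi]).
    by move: d; rewrite !vid_compl ?(vcod_comp L) // ?(vcod_id L) // -(vdom_id L A).
  rewrite (compA1 q p1) -e; have := comp_idcl cchi.
  by rewrite (vcod_comp L) // (vcod_id L) => /= ->.
have [_ t1 _ _] := d1; have [_ t2 _ _] := d2.
rewrite -[phi1](comp_idl1 L t1) -[phi2](comp_idl1 L t2) -ee.
by rewrite -(compA1 (composable1 ceps d1 hA) p2) -(compA1 (composable1 ceps d2 hA) p2) e'.
Qed.


(** * Companions *)

Definition companion f J (eps : cell K) : Prop :=
  iscell eps [:: J] [::] f (vid (vcod f)) /\ cartesian eps.

Lemma companion_dom f J eps : companion f J eps -> hdom J = vdom f.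
Proof. by move=> [/iscell_src[]]. Qed.

Lemma companion_cod f J eps : companion f J eps -> hcod J = vcod f.
Proof. by move=> [/iscell_src[_ /=]]; rewrite (vdom_id L). Qed.

(** The unit is the factorization of [idv f] through the cartesian cell [eps]; the second companion
    identity holds because it does after composition with [eps]. *)
Lemma companion_unit f J eps : companion f J eps ->
  exists eta, [/\ iscell eta [::] [:: J] (vid (vdom f)) f, comp eps [:: eta] = idv f
                & odot eta eps = idh J].
Proof.
move=> [ceps Ceps]; have cf : iscell (idv f) [::] [::] (f ∘ vid (vdom f)) (vid (vcod f) ∘ f).
  by rewrite (vcomp1f L) (vcompf1 L); exact: idv_iscell.
have [||eta ceta e] := cart_ex Ceps ceps cf; rewrite ?(vcod_id L) ?(vdom_id L) //.
exists eta; split=> //.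
have co := odot_iscell ceta ceps isT.
have ci := idh_cell L J.
rewrite (companion_dom (conj ceps Ceps)) (companion_cod (conj ceps Ceps)) in ci.
apply: (cart_inj Ceps ceps co ci); first by rewrite (vcod_id L).
have := comp_odot_l ceps ceta ceps; rewrite (vcod_id L) => -> //.
rewrite -e (comp_idcl ceps) (odot_idl ceps).
have := comp_idcr _ ceps => /= -> //.
Qed.

(* The cell f_* => M corresponding to a 2-cell phi : y => g ∘ f. *)
Definition transpose phi g eps : cell K := odot phi (lwhisk g eps).

Lemma transpose_iscell phi y g f J eps : companion f J eps ->
  iscell phi [::] [::] y (g ∘ f) -> vcod f = vdom g ->
  iscell (transpose phi g eps) [:: J] [::] y g.
Proof.
move=> [ceps _] cphi fg.
have c := comp1_iscell (idv_iscell g) ceps fg.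
have := odot_iscell cphi c isT; by rewrite fg (vcompf1 L).
Qed.

(** For empty [H] this turns a factorization through the transpose into the one that defines
    absolute left liftings, with [comp eps [:: zeta]] as the 2-cell. *)
Lemma comp_transpose phi y g f J eps zeta H h k : companion f J eps ->
  iscell phi [::] [::] y (g ∘ f) -> vcod f = vdom g ->
  iscell zeta H [:: J] h k -> vcod h = vdom f ->
  comp (transpose phi g eps) [:: zeta]
    = odot (comp phi [:: idv h]) (comp (idv g) [:: comp eps [:: zeta]]).
Proof.
move=> [ceps _] cphi fg czeta hf.
have c := comp1_iscell (idv_iscell g) ceps fg.
have hy : vcod h = vdom y.
  by have := iscell_src cphi => /= ->; rewrite (vdom_comp L).
rewrite (odot_comp_r cphi c czeta hy) // compA1 //.
  exact: composable1 ceps czeta hf.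
exact: composable1 (idv_iscell g) ceps fg.
Qed.

(** By interchange the left side is [theta] composed with [odot eta eps], an identity cell. Hence
    every cell from the companion is a transpose. *)
Lemma transpose_unit theta g f J eps eta y : companion f J eps ->
  iscell eta [::] [:: J] (vid (vdom f)) f -> odot eta eps = idh J ->
  iscell theta [:: J] [::] y g ->
  transpose (comp theta [:: eta]) g eps = theta.
Proof.
move=> [ceps Ceps] ceta e ctheta.
have dy : vdom f = vdom y.
  by have := iscell_src ctheta => -[<- _]; have := iscell_src ceps => -[<-].
have := comp_odot_l ctheta ceta ceps; rewrite (vcod_id L) => /(_ dy isT).
rewrite /transpose /lwhisk => <-; rewrite e -[RHS](comp_idr L); last by case: ctheta => ->.
by case: ctheta => ->.
Qed.

Lemma vertical_iscell_dom phi f g : iscell phi [::] [::] f g -> vdom f = vdom g.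
Proof. exact: iscell_src. Qed.

Lemma vertical_iscell_cod phi f g : iscell phi [::] [::] f g -> vcod f = vcod g.
Proof. exact: iscell_tgt. Qed.

(** Composition with [eps] is a bijection from cells into [J] with empty source onto 2-cells
    [f ∘ p => q], and it matches factorizations through the transpose with those of the lifting. *)
Lemma lifting_of_cartesian phi y g f J eps : companion f J eps ->
  iscell phi [::] [::] y (g ∘ f) -> vcod f = vdom g ->
  cartesian (transpose phi g eps) -> @absolute_left_lifting (V K) phi y f g.
Proof.
move=> cf cphi fg C; have ct := transpose_iscell cf cphi fg.
have [ceps Ceps] := cf; have dy := vertical_iscell_dom cphi; rewrite (vdom_comp L) // in dy.
split=> //= p q a py qp qf ca.
have qf' : vcod q = vdom (vid (vcod f)) by rewrite (vdom_id L).
have qg : vcod q = vdom g by congruence.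
have pf : vcod p = vdom f by congruence.
have [zeta czeta e] := cart_ex C ct ca py qg.
exists (comp eps [:: zeta]); split.
  split; first by have := comp1_iscell ceps czeta pf; rewrite -qf (vcomp1f L).
  by rewrite e (comp_transpose cf cphi fg czeta pf).
move=> c [cc ec].
have [|||zeta' czeta' e'] := @cart_ex eps c _ [::] _ _ _ p q Ceps ceps => //.
  by rewrite -qf (vcomp1f L).
rewrite e'; do 2!f_equal; apply: (cart_inj C ct czeta czeta' py).
by rewrite -e ec (comp_transpose cf cphi fg czeta' pf) e'.
Qed.

(** The same bijection read backwards. It yields the universal property of the transpose against
    cells with empty horizontal source; tabulations extend it to all paths. *)
Lemma vertical_factor_of_lifting phi y g f J eps : companion f J eps ->
  @absolute_left_lifting (V K) phi y f g ->
  (forall chi h k, iscell chi [::] [::] (y ∘ h) (g ∘ k) ->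
     vcod h = vdom y -> vcod k = vdom g ->
     exists2 zeta, iscell zeta [::] [:: J] h k &
       chi = comp (transpose phi g eps) [:: zeta]) /\
  (forall z1 z2 h k, iscell z1 [::] [:: J] h k -> iscell z2 [::] [:: J] h k ->
     vcod h = vdom y ->
     comp (transpose phi g eps) [:: z1] = comp (transpose phi g eps) [:: z2] -> z1 = z2).
Proof.
move=> cf [/= cphi fg lift]; have [ceps Ceps] := cf.
have dy := vertical_iscell_dom cphi; rewrite (vdom_comp L) // in dy.
have key z h k : iscell z [::] [:: J] h k -> vcod h = vdom y ->
    [/\ iscell (comp eps [:: z]) [::] [::] (f ∘ h) k, vdom k = vdom h & vcod k = vcod f].
  move=> cz hy; have hf : vcod h = vdom f by congruence.
  have := comp1_iscell ceps cz hf; have /= kc := iscell_cod ceps cz hf.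
  rewrite (vdom_id L) in kc; rewrite -kc (vcomp1f L) => cz'; split=> //.
  by have /= := iscell_src cz.
split=> [chi h k cchi hy kg|z1 z2 h k c1 c2 hy e].
  have hf : vcod h = vdom f by congruence.
  have kf : vcod k = vcod f by congruence.
  have kh : vdom k = vdom h.
    by have := vertical_iscell_dom cchi; rewrite !(vdom_comp L) // => ->.
  have [c [[cc ec] _]] := lift h k chi hy kh kf cchi.
  have [|||zeta czeta e] := @cart_ex eps c _ [::] _ _ _ h k Ceps ceps => //.
  - by rewrite -kf (vcomp1f L).
  - by rewrite (vdom_id L).
  by exists zeta => //; rewrite (comp_transpose cf cphi fg czeta hf) -e.
have hf : vcod h = vdom f by congruence.
have [d1 kh kf] := key _ _ _ c1 hy; have [d2 _ _] := key _ _ _ c2 hy.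
have ca := comp1_iscell (transpose_iscell cf cphi fg) c1 hy.
have [c [_ U]] := lift h k _ hy kh kf ca.
apply: (cart_inj Ceps ceps c1 c2 hf).
rewrite -(U (comp eps [:: z1])) ?(U (comp eps [:: z2])) //; split=> //.
  by rewrite e (comp_transpose cf cphi fg c2 hf).
by rewrite (comp_transpose cf cphi fg c1 hf).
Qed.

(** * Units *)

(** Paths of cells bounded by vertical identities, for which composability is a matter of objects
    only. *)
Fixpoint chain A (s : seq (cell K)) B : Prop :=
  if s is phi :: s' then vsrc phi = vid A /\ exists C, vtgt phi = vid C /\ chain C s' B
  else A = B.

Lemma chain_cat A s1 B s2 C : chain A s1 B -> chain B s2 C -> chain A (s1 ++ s2) C.
Proof.
elim: s1 A => [|phi s1 IH] A /=; first by move=> ->.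
by move=> [-> [D [-> h]]] h2; split=> //; exists D; split=> //; apply: IH.
Qed.

Lemma chain_linked A phi s B : chain A (phi :: s) B ->
  [/\ linked phi s, vsrc phi = vid A & vtgt (last phi s) = vid B].
Proof.
elim: s phi A => [|phi' s IH] phi A /= [-> [C [-> h]]]; first by rewrite h.
by have [l e e'] := IH phi' C h; split.
Qed.

Lemma chain_composable psi A s B : chain A s B -> s <> [::] ->
  flatten (map (@htgt K) s) = hsrc psi -> vdom (vsrc psi) = A -> composable psi s.
Proof.
by case: s => // phi s /chain_linked[l e _] _ f d; split=> //; rewrite e d (vcod_id L).
Qed.

(** Pairs of mutually inverse horizontal cells. The first components will be the identity and
    cartesian cells that flank a unit cell in the definition of [cocartesian]. *)
Fixpoint inverse_path A (ps : seq (cell K * cell K)) B : Prop :=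
  if ps is p :: ps' then
    exists J1 J2 C,
      [/\ iscell p.1 [:: J1] [:: J2] (vid A) (vid C),
          iscell p.2 [:: J2] [:: J1] (vid A) (vid C),
          comp p.1 [:: p.2] = idh J2 & comp p.2 [:: p.1] = idh J1] /\
      inverse_path C ps' B
  else A = B.

Definition swap (p : cell K * cell K) := (p.2, p.1).

Lemma inverse_path_swap A ps B : inverse_path A ps B -> inverse_path A (map swap ps) B.
Proof.
elim: ps A => //= p ps IH A [J1 [J2 [C [[? ? ? ?] h]]]].
by exists J2, J1, C; split=> //; apply: IH.
Qed.

Lemma inverse_path_chain A ps B : inverse_path A ps B -> chain A (map fst ps) B.
Proof.
elim: ps A => //= p ps IH A [J1 [J2 [C [[[_ _ -> ->] _ _ _] h]]]].
by split=> //; exists C; split=> //; apply: IH.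
Qed.

Lemma inverse_path_flatten A ps B : inverse_path A ps B ->
  [/\ flatten (map (@htgt K) (map fst ps)) = flatten (map (@hsrc K) (map snd ps)),
      all_prop (fun p => composable p.1 [:: p.2]) ps,
      all_prop (@unary K) (map fst ps),
      hpath A (flatten (map (@htgt K) (map fst ps))) B &
      map (fun p => comp p.1 [:: p.2]) ps
        = map (@idh K) (flatten (map (@htgt K) (map fst ps)))].
Proof.
elim: ps A => [|p ps IH] A //= [J1 [J2 [C [[c1 c2 e1 _] h]]]].
have [i1 i2 i3 i4 i5] := IH C h.
have AA : vcod (vid A) = vdom (vid A) by rewrite (vcod_id L) (vdom_id L).
have := composable1 c1 c2 AA; have := iscell_tgt c1; rewrite !(vcod_id L).
move=> /= [JA JC] co.
case: (c1) (c2) => _ t1 _ _ [s2 _ _ _].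
split=> /=; rewrite ?t1 ?s2 ?e1 /=.
- by rewrite i1.
- by split.
- by split=> //; exists J2.
- by rewrite JA JC.
- by rewrite i5.
Qed.

Lemma all_prop_cat T (P : T -> Prop) s1 s2 :
  all_prop P s1 -> all_prop P s2 -> all_prop P (s1 ++ s2).
Proof. by elim: s1 => //= x s1 IH [px ps] h; split=> //; apply: IH. Qed.

Lemma chain_idh A H B : hpath A H B -> chain A (map (@idh K) H) B.
Proof.
elim: H A => //= J H IH A [<- p]; have [_ _ -> ->] := idh_cell L J.
by split=> //; exists (hcod J); split=> //; apply: IH.
Qed.

Lemma flatten_hsrc_idh H : flatten (map (@hsrc K) (map (@idh K) H)) = H.
Proof. by elim: H => //= J H ->; have [-> _ _ _] := idh_cell L J. Qed.

Lemma flatten_htgt_idh H : flatten (map (@htgt K) (map (@idh K) H)) = H.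
Proof. by elim: H => //= J H ->; have [_ -> _ _] := idh_cell L J. Qed.

Lemma comp_idh_gap psi A H1 B H2 C : hpath A H1 B -> hpath B H2 C ->
  hsrc psi = H1 ++ H2 -> vdom (vsrc psi) = A ->
  comp psi (map (@idh K) H1 ++ idv (vid B) :: map (@idh K) H2) = psi.
Proof.
move=> p1 p2 e d; have q1 := chain_idh p1; have q2 := chain_idh p2.
(* If both paths are empty, deleting the vertical identity would leave no cell to compose with, so
   [comp_idr0] is used instead. *)
have [n|n] : H1 ++ H2 = [::] \/ H1 ++ H2 <> [::] by case: (H1 ++ H2); [left|right].
  move: n p1 e d; case: (H1) (H2) => [|//] [|//] _ /= <- e <-; exact: (comp_idr0 L).
have [iv1 iv2 iv3 iv4] := idv_iscell (vid B).
have c1 : chain A (map (@idh K) H1 ++ map (@idh K) H2) C := chain_cat q1 q2.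
have c2 : chain A (map (@idh K) H1 ++ idv (vid B) :: map (@idh K) H2) C.
  by apply: chain_cat q1 _ => /=; rewrite iv3 iv4; split=> //; exists B.
rewrite (comp_idm L) -?map_cat -?e; first by apply: (comp_idr L); rewrite e.
  rewrite e map_cat; apply: (chain_composable c1) => //.
    by move: n; case: (H1) (H2) => [|? ?] [|? ?].
  by rewrite -map_cat flatten_htgt_idh.
apply: (chain_composable c2) => //; first by case: (map _ H1).
by rewrite map_cat flatten_cat /= iv2 !flatten_htgt_idh.
Qed.

Lemma comp_paths psi (ps : seq (cell K * cell K)) A B :
  chain A (map fst ps) B -> chain A (map snd ps) B -> ps <> [::] ->
  all_prop (fun p => composable p.1 [:: p.2]) ps ->
  flatten (map (@htgt K) (map fst ps)) = hsrc psi ->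
  flatten (map (@htgt K) (map snd ps)) = flatten (map (@hsrc K) (map fst ps)) ->
  vdom (vsrc psi) = A ->
  comp (comp psi (map fst ps)) (map snd ps) = comp psi [seq comp p.1 [:: p.2] | p <- ps].
Proof.
move=> c1 c2 n ap e1 e2 d.
have n1 : map fst ps <> [::] by case: (ps) n.
have n2 : map snd ps <> [::] by case: (ps) n.
have p1 := chain_composable c1 n1 e1 d.
have p2 : composable (comp psi (map fst ps)) (map snd ps).
  have [s1 _ s3 _] := comp_cell L p1; apply: (chain_composable c2) => //.
    by rewrite s1.
  rewrite s3; case: (map fst ps) c1 p1 n1 => // phi s /chain_linked[_ /= -> _] [_ _ v] _.
  by rewrite (vdom_comp L v) (vdom_id L).
pose ps' := [seq (p.1, [:: p.2]) | p <- ps].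
have f1 : map fst ps' = map fst ps by rewrite -map_comp.
have f2 : flatten (map snd ps') = map snd ps by rewrite -map_comp; exact: flatten_map1.
have := @comp_assoc _ L psi ps'; rewrite f1 f2 -map_comp => -> //.
by rewrite /ps'; elim: (ps) ap => [|p s IH] /= => [|[? ?]] //; split=> //; exact: IH.
Qed.

(** Composition with the path of inverse cells is a two-sided inverse of composition with the given
    path, so factorizations exist and are unique. *)
Lemma unit_weakly_cocartesian A I eta eps ls rs B C :
  iscell eta [::] [:: I] (vid A) (vid A) -> iscell eps [:: I] [::] (vid A) (vid A) ->
  comp eta [:: eps] = idh I -> comp eps [:: eta] = idv (vid A) ->
  inverse_path B ls A -> inverse_path A rs C ->
  weakly_cocartesian (map fst (ls ++ (eta, eps) :: rs)).
Proof.
move=> ceta ceps e1 e2 Il Ir; set ps := ls ++ _.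
have AA : vcod (vid A) = vdom (vid A) by rewrite (vcod_id L) (vdom_id L).
have p1 := composable1 ceta ceps AA; have p2 := composable1 ceps ceta AA.
have [t1 t2 t3 t4] := ceta; have [s1 s2 s3 s4] := ceps.
have [l1 l2 l3 l4 l5] := inverse_path_flatten Il.
have [r1 r2 r3 r4 r5] := inverse_path_flatten Ir.
have [l1' l2' _ l4' l5'] := inverse_path_flatten (inverse_path_swap Il).
have [r1' r2' _ r4' r5'] := inverse_path_flatten (inverse_path_swap Ir).
have fs (s : seq (cell K * cell K)) : map fst (map swap s) = map snd s by rewrite -map_comp.
have sf (s : seq (cell K * cell K)) : map snd (map swap s) = map fst s by rewrite -map_comp.
have cs (s : seq (cell K * cell K)) :
    [seq comp p.1 [:: p.2] | p <- map swap s] = [seq comp p.2 [:: p.1] | p <- s].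
  by rewrite -map_comp.
rewrite !fs !sf !cs in l1' l4' l5' r1' r4' r5'.
have c1 : chain B (map fst ps) C.
  rewrite map_cat; apply: chain_cat (inverse_path_chain Il) _ => /=.
  rewrite t3 t4; split=> //; exists A; split=> //; exact: inverse_path_chain.
have c2 : chain B (map snd ps) C.
  rewrite map_cat -!fs; apply: chain_cat (inverse_path_chain (inverse_path_swap Il)) _ => /=.
  rewrite s3 s4; split=> //; exists A; split=> //; apply: inverse_path_chain.
  exact: inverse_path_swap.
have n : ps <> [::] by rewrite /ps; case: (ls).
have a1 : all_prop (fun p => composable p.1 [:: p.2]) ps.
  by apply: all_prop_cat.
have a2 : all_prop (fun p => composable p.1 [:: p.2]) (map swap ps).
  by rewrite map_cat; apply: all_prop_cat.
have f1 : flatten (map (@htgt K) (map fst ps)) = flatten (map (@hsrc K) (map snd ps)).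
  by rewrite !map_cat !flatten_cat /= l1 r1 t2 s1.
have f2 : flatten (map (@htgt K) (map snd ps)) = flatten (map (@hsrc K) (map fst ps)).
  by rewrite !map_cat !flatten_cat /= l1' r1' s2 t1.
have key psi : hsrc psi = flatten (map (@htgt K) (map fst ps)) -> vdom (vsrc psi) = B ->
    comp (comp psi (map fst ps)) (map snd ps) = psi.
  move=> e d; rewrite (comp_paths c1 c2) //.
  have -> : [seq comp p.1 [:: p.2] | p <- ps] = map (@idh K) (hsrc psi).
    by rewrite e !map_cat flatten_cat /= !map_cat l5 r5 t2 e1.
  by apply: (comp_idr L); rewrite e !map_cat flatten_cat /= t2; case: (flatten _).
(* In this order the middle pair composes to a vertical identity, which is removed by
   [comp_idh_gap]. *)
have key' psi : hsrc psi = flatten (map (@hsrc K) (map fst ps)) -> vdom (vsrc psi) = B ->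
    comp (comp psi (map snd ps)) (map fst ps) = psi.
  move=> e d; have := @comp_paths psi (map swap ps) B C; rewrite fs sf cs f2 => -> //.
    rewrite map_cat /= l5' r5' e2; apply: (comp_idh_gap l4' r4') => //.
    by rewrite e !map_cat flatten_cat /= l1' r1' t1.
  by case: (ps) n.
have un : all_prop (@unary K) (map fst ps).
  by rewrite map_cat; apply: all_prop_cat => //=; split=> //; exists I.
have n1 : map fst ps <> [::] by case: (ps) n.
have n2 : map snd ps <> [::] by case: (ps) n.
case E: (map fst ps) c1 key key' un n1 => [//|phi s] c1 key key' un _.
rewrite E in f1 f2.
have [li v1 v2] := chain_linked c1.
split=> // psi h k; rewrite v1 v2 !(vcod_id L) => Bh Ck g1 g2 g3.
have dpsi : vdom (vsrc psi) = B by rewrite g2 Bh (vcompf1 L).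
have q2 : composable psi (map snd ps) by apply: (chain_composable c2) => //; rewrite g1.
exists (comp psi (map snd ps)); split.
  split; last by rewrite key'.
  have := comp_cell L q2; rewrite f1.
  case: (map snd ps) c2 n2 => // phi' s' /chain_linked[_ /= -> ->] _.
  by rewrite g2 g3 !vid_compr.
move=> psi' [[i1 i2 i3 i4] ->]; rewrite key // i3; by [].
Qed.

End Calculus.

(** * Tabulations and comma objects *)

Section Tabulations.
Variable K : avdc.
Let L := avdcP K.
Hypothesis equip : equipment K.
Hypothesis tabs : has_cocartesian_tabulations K.
Implicit Types (A B : ob K) (f g h k l m u v : vert K).
Implicit Types (phi psi chi theta : cell K) (J : hor K) (H Js Ls : seq (hor K)).

(** * Shortening horizontal paths by tabulations *)

Lemma restriction_along J u : vcod u = hcod J ->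
  exists R cart, iscell cart [:: R] [:: J] (vid (hdom J)) u /\ cartesian cart.
Proof. by move=> uJ; apply: equip => //; exact: (vcod_id L). Qed.

(** The layer consists of the tabulation [pi] of [J], the cartesian cell restricting the next
    morphism along the vertical target of [pi], and identities. Composing with it shortens a
    horizontal source by one; the last clause leaves room for one more morphism on the left. *)
Lemma cocartesian_layer A B J H : hpath A (J :: H) B ->
  exists pi r,
    [/\ flatten (map (@htgt K) (pi :: r)) = J :: H,
        size (flatten (map (@hsrc K) (pi :: r))) = size H,
        vcod (vsrc pi) = A, weakly_cocartesian (pi :: r) &
        forall J' R cart, iscell cart [:: R] [:: J'] (vid (hdom J')) (vsrc pi) ->
          cartesian cart -> weakly_cocartesian (cart :: pi :: r)].
Proof.
move=> /= [JA pH]; have [pi [[[s0 t1] _ _] [_ [_ _ W]]]] := tabs J.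
have := htgt_path L pi; rewrite t1 /= => -[piA piB].
suff [r [re rt rs]] : exists r, [/\ right_extension (vtgt pi) r,
    flatten (map (@htgt K) r) = H & size (flatten (map (@hsrc K) r)) = size H].
  have W0 : weakly_cocartesian (pi :: r) by apply: (W [::] r) => //; left.
  exists pi, r; split=> //.
  - by rewrite /= t1 rt.
  - by rewrite /= s0 rs.
  - by congruence.
  move=> J' R cart cc Ccart; apply: (W [:: cart] r) => //=; right.
  exists (hdom J'), [::], J', R, cart; split=> //=; split=> //.
  by have /= [_] := iscell_tgt cc.
case: H pH => [|J2 H] pH; first by exists [::]; split=> //; left.
have [||R [cart [cc Ccart]]] := @equip J2 (vtgt pi) (vid (hcod J2)).
- by rewrite -piB; case: pH.
- exact: (vcod_id L).
exists (cart :: map (@idh K) H); split.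
- by right; exists B, H, J2, R, cart; split=> //; rewrite -piB.
- by rewrite /= flatten_htgt_idh; case: cc => _ ->.
- by rewrite /= flatten_hsrc_idh; case: cc => ->.
Qed.

(** Induction on the length of the horizontal source: a layer is weakly cocartesian, so existence
    and uniqueness for a path reduce to those for the shorter path under the layer. *)
Lemma vertical_factor_cartesian psi Js Ls f g : iscell psi Js Ls f g -> size Js <= 1 ->
  (forall chi h k, iscell chi [::] Ls (f ∘ h) (g ∘ k) ->
     vcod h = vdom f -> vcod k = vdom g ->
     exists2 phi, iscell phi [::] Js h k & chi = comp psi [:: phi]) ->
  (forall phi1 phi2 h k, iscell phi1 [::] Js h k -> iscell phi2 [::] Js h k ->
     vcod h = vdom f -> comp psi [:: phi1] = comp psi [:: phi2] -> phi1 = phi2) ->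
  cartesian psi.
Proof.
move=> cpsi sJ ex0 inj0.
have inj phi1 phi2 H h k : iscell phi1 H Js h k -> iscell phi2 H Js h k ->
    vcod h = vdom f -> comp psi [:: phi1] = comp psi [:: phi2] -> phi1 = phi2.
  have [n sH] : exists n, size H = n by eexists.
  elim: n H sH phi1 phi2 h k => [[|//] _|n IH [//|J H] [sH]] phi1 phi2 h k c1 c2 hf e.
    exact: inj0 c1 c2 hf e.
  have [pi [r [ht hs va W _]]] := cocartesian_layer (iscell_src c1).
  have d1 : composable phi1 (pi :: r) by apply: (composable_wcc W _ va); rewrite ht; exact: c1.
  have d2 : composable phi2 (pi :: r) by apply: (composable_wcc W _ va); rewrite ht; exact: c2.
  have p1 := composable1 cpsi c1 hf; have p2 := composable1 cpsi c2 hf.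
  apply: (@wcc_inj _ _ _ _ _ Js h k W) => //; try by rewrite ht.
  have i1 := composable_iscell d1; have i2 := composable_iscell d2.
  case: (c1) (c2) i1 i2 => _ -> -> -> [_ -> -> ->] i1 i2.
  apply: (IH _ _ _ _ _ _ i1 i2); first by rewrite hs.
    by rewrite (vcod_comp L).
  by rewrite (compA1 d1 p1) (compA1 d2 p2) e.
apply: (cart_intro cpsi sJ) => // chi H h k.
have [n sH] : exists n, size H = n by eexists.
elim: n H sH chi h k => [[|//] _|n IH [//|J H] [sH]] chi h k cchi hf kg.
  exact: ex0 cchi hf kg.
have pJ := iscell_src cchi; rewrite !(vdom_comp L) // in pJ.
have [pi [r [ht hs va W _]]] := cocartesian_layer pJ.
have va' : vcod (vsrc pi) = vdom (f ∘ h) by rewrite (vdom_comp L).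
have d : composable chi (pi :: r) by apply: (composable_wcc W _ va'); rewrite ht; exact: cchi.
have vb : vcod (vtgt (last pi r)) = vdom k.
  by have := composable_cod d; case: (cchi) => _ _ _ ->; rewrite (vdom_comp L).
have := composable_iscell d; case: (cchi) => _ -> -> ->.
rewrite -!(vcompA L) // => i.
have [|||zeta czeta e] := IH _ _ _ _ _ i; rewrite ?hs ?(vcod_comp L) //.
have [phi cphi e'] := wcc_ex W czeta va vb; rewrite ht in cphi.
exists phi => //.
have p := composable1 cpsi cphi hf.
have d' : composable phi (pi :: r) by apply: (composable_wcc W _ va); rewrite ht; exact: cphi.
(* The equation needs checking only after composition with the layer. *)
apply: (wcc_inj W) (va') _; rewrite ?ht; first exact: cchi.
  exact: comp1_iscell cpsi cphi hf.
by rewrite e e' compA1.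
Qed.

(** * Left Kan extensions tested on vertical cells *)

Definition vertical_lan theta J d l : Prop :=
  (forall phi k, iscell phi [:: J] [::] d k ->
     exists2 c, iscell c [::] [::] l k & phi = odot theta c) /\
  (forall c1 c2 k, iscell c1 [::] [::] l k -> iscell c2 [::] [::] l k ->
     odot theta c1 = odot theta c2 -> c1 = c2).

(** Induction on the length of the path after [J]. A layer for that path, preceded by the
    restriction of [J] along the vertical source of [pi], shortens it but replaces [eta] by its
    composite with a cartesian cell; hence the hypothesis ranges over all such restrictions. *)
Lemma vertical_lan_defines eta J d l : iscell eta [:: J] [::] d l ->
  (forall R cart u, iscell cart [:: R] [:: J] (vid (hdom J)) u -> cartesian cart ->
     vertical_lan (comp eta [:: cart]) R d (l ∘ u)) ->
  defines_lan eta.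
Proof.
move=> ceta vlan.
suff main n H phi k : size H = n -> iscell phi (J :: H) [::] d k ->
    (exists2 c, iscell c H [::] l k & phi = odot eta c) /\
    (forall c1 c2, iscell c1 H [::] l k -> iscell c2 H [::] l k ->
       odot eta c1 = odot eta c2 -> c1 = c2).
  split; [by exists J; case: ceta | by case: ceta |].
  case: (ceta) => -> _ -> -> H phi e1 e2 e3.
  have [[c cc e] inj] := main _ H phi (vtgt phi) erefl (And4 e1 e2 e3 erefl).
  exists c; split=> // c' [cc' e']; apply: inj => //; congruence.
elim: n J H eta d l ceta vlan phi k => [|n IH] J [|J1 H] eta d l ceta vlan phi k // sH cphi.
  (* For the empty path take the identity cell as the restriction. *)
  have ci := idh_cell L J; have [ex inj] := vlan _ _ _ ci (idh_cartesian J).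
  have lJ : vdom l = hcod J by have /= [_] := iscell_src ceta.
  have e : comp eta [:: idh J] = eta.
    by have := comp_idcr _ ceta => /= ->.
  by rewrite e -lJ (vcompf1 L) in ex inj; split=> [|c1 c2]; [exact: ex|exact: inj].
have [JA pJ1] := iscell_src cphi.
have lJ : vdom l = hcod J by have /= [_] := iscell_src ceta.
have dJ : vdom d = hdom J by have /= [<-] := iscell_src ceta.
have [pi [r [ht hs va W W']]] := cocartesian_layer pJ1.
have [R [cart [cc Ccart]]] := restriction_along va.
have {}W' := W' _ _ _ cc Ccart.
have td : vcod (vid (hdom J)) = vdom d by rewrite (vcod_id L).
have ul : vcod (vsrc pi) = vdom l by congruence.
(* The hypothesis is inherited by the restricted cell, since cartesian cells compose. *)
have vlan' R' cart' u : iscell cart' [:: R'] [:: R] (vid (hdom R)) u ->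
    cartesian cart' ->
    vertical_lan (comp (comp eta [:: cart]) [:: cart']) R' d ((l ∘ vsrc pi) ∘ u).
  move=> cc' Ccart'.
  have uR : vcod u = vdom (vsrc pi).
    have /= [_] := iscell_tgt cc' => <-.
    by have /= [_] := iscell_src cc.
  have RJ : hdom R = hdom J by have /= [->] := iscell_src cc; rewrite (vdom_id L).
  have k1 : vcod (vid (hdom R)) = vdom (vid (hdom J)).
    by rewrite (vcod_id L) (vdom_id L).
  rewrite -compA1; [|exact: composable1 cc cc' k1|exact: composable1 ceta cc td].
  rewrite -(vcompA L) //; apply: vlan; last exact: cart_comp Ccart cc Ccart' cc' k1.
  have := comp1_iscell cc cc' k1; rewrite RJ.
  have := vcompf1 L (vid (hdom J)); by rewrite (vdom_id L) => ->.
have ceta' := comp1_iscell ceta cc td; rewrite -dJ (vcompf1 L) in ceta'.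
(* Interchange splits the extended layer: [cart] acts on [eta] and the rest on [c]. *)
have comp_odot' c : iscell c (J1 :: H) [::] l k ->
    comp (odot eta c) (cart :: pi :: r) = odot (comp eta [:: cart]) (comp c (pi :: r)).
  move=> cc'; symmetry; apply: (@comp_odot _ eta c cart [::] pi r) => //.
  - exact: composable1 ceta cc td.
  - by apply: (composable_wcc W _ ul); rewrite ht; exact: cc'.
  - by case: ceta cc' => _ _ _ -> [].
  - by case: cc => _ _ _ ->.
  - by case: ceta cc' => _ -> _ _ [_ ->].
have hts : flatten (map (@htgt K) (cart :: pi :: r)) = J :: J1 :: H.
  by case: cc => _ /= -> _ _; rewrite -ht.
have va' : vcod (vsrc cart) = vdom d by case: cc => _ _ ->.
have d1 : composable phi (cart :: pi :: r).
  by apply: (composable_wcc W' _ va'); rewrite hts; exact: cphi.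
have vb : vcod (vtgt (last pi r)) = vdom k.
  by have := composable_cod d1; case: (cphi) => _ _ _ ->.
have i1 := composable_iscell d1.
have {i1} i1 : iscell (comp phi (cart :: pi :: r))
    (R :: flatten (map (@hsrc K) (pi :: r))) [::] d (k ∘ vtgt (last pi r)).
  case: (cphi) (cc) i1 => _ -> -> -> [/= -> _ -> _].
  by rewrite -dJ (vcompf1 L).
have [|[zeta czeta ezeta] inj] := IH R _ _ _ _ ceta' vlan' _ _ _ i1.
  by rewrite hs; case: sH.
split=> [|c1 c2 cc1 cc2 e].
  (* The factor [zeta] of the shortened cell descends along the layer to a factor of [phi]. *)
  have [c cc' ec] := wcc_ex W czeta ul vb; rewrite ht in cc'.
  exists c => //; apply: (wcc_inj W' _ _ va'); rewrite ?hts; first exact: cphi.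
    exact: odot_iscell ceta cc' isT.
  by rewrite comp_odot' // -ec.
apply: (wcc_inj W _ _ ul); rewrite ?ht; [exact: cc1|exact: cc2|].
have d2 : composable c1 (pi :: r) by apply: (composable_wcc W _ ul); rewrite ht; exact: cc1.
have d3 : composable c2 (pi :: r) by apply: (composable_wcc W _ ul); rewrite ht; exact: cc2.
have i2 := composable_iscell d2; have i3 := composable_iscell d3.
case: (cc1) (cc2) i2 i3 => _ -> -> -> [_ -> -> ->] i2 i3.
by apply: (inj _ _ i2 i3); rewrite -!comp_odot' // e.
Qed.

(** * Restrictions of companions *)

(** Pasting a unary restriction of the companion with [eps] produces the nullary restriction of the
    codomain of [f] along [f ∘ u] and [v], which an equipment does not provide by itself. *)
Lemma companion_restriction f J eps u v : companion f J eps ->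
  vcod u = vdom f -> vcod v = vcod f ->
  exists R cart, [/\ iscell cart [:: R] [:: J] u v, cartesian cart,
    iscell (comp eps [:: cart]) [:: R] [::] (f ∘ u) v & cartesian (comp eps [:: cart])].
Proof.
move=> cf uf vf; have [ceps Ceps] := cf.
have [||R [cart [cc Ccart]]] := @equip J u v.
- by rewrite (companion_dom cf).
- by rewrite (companion_cod cf).
exists R, cart; split=> //; last exact: cart_comp Ceps ceps Ccart cc uf.
by have := comp1_iscell ceps cc uf; rewrite -vf (vcomp1f L).
Qed.

(** The companion of the composite is the restriction [g_*(f, id)]. *)
Lemma has_companion_comp g f : vcod f = vdom g -> has_companion g -> has_companion (g ∘ f).
Proof.
move=> fg [J [eps cg]].
have [|R [cart [_ _ c C]]] := companion_restriction (v := vid (vcod g)) cg fg.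
  exact: (vcod_id L).
by exists R, (comp eps [:: cart]); rewrite (vcod_comp L).
Qed.

(** Composition with the weakly cocartesian [kappa] is a bijection from cells out of [J] onto
    2-cells, and it turns factorization through [theta] into the universal property along [q]. The
    converse below uses the same bijection. *)
Lemma left_kan_of_vertical_lan theta kappa J d l p q :
  iscell theta [:: J] [::] d l -> iscell kappa [::] [:: J] p q ->
  weakly_cocartesian [:: kappa] -> vertical_lan theta J d l ->
  @left_kan (V K) (comp theta [:: kappa]) (d ∘ p) q l.
Proof.
move=> ct ck W [ex inj].
have [Jd Jl] := iscell_src ct; have [Jp Jq] := iscell_tgt ck; rewrite /= in Jl Jq.
have pd : vcod p = vdom d by congruence.
have ql : vcod q = vdom l by congruence.
have dl : vcod d = vcod l := iscell_tgt ct.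
have := ck; move=> [k1 k2 k3 k4].
have lan_comp c k : iscell c [::] [::] l k ->
    comp (odot theta c) [:: kappa] = odot (comp theta [:: kappa]) (comp c [:: idv q]).
  by move=> cc; exact: odot_comp_l ct cc ck pd isT.
have va : vcod (vsrc kappa) = vdom d by rewrite k3.
split=> //=; first exact: comp1_iscell ct ck pd.
move=> k a kq kc ca; rewrite (vcod_comp L) // in kc.
have i : iscell a (flatten (map (@hsrc K) [:: kappa])) [::] (d ∘ vsrc kappa)
    (k ∘ vtgt (last kappa [::])) by rewrite /= k1 k3 k4.
have [||phi cphi e] := wcc_ex W i; rewrite /= ?k3 ?k4 //.
rewrite /= k2 in cphi.
have [c cc ec] := ex _ _ cphi; exists c; split; first by rewrite e ec (lan_comp _ _ cc).
move=> c' [cc' ec']; apply: (inj _ _ _ cc cc'); apply: (wcc_inj W _ _ va).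
- by rewrite /= k2; exact: odot_iscell ct cc isT.
- by rewrite /= k2; exact: odot_iscell ct cc' isT.
by rewrite (lan_comp _ _ cc) (lan_comp _ _ cc') -ec' e ec (lan_comp _ _ cc).
Qed.

Lemma vertical_lan_of_left_kan theta kappa J d l p q :
  iscell theta [:: J] [::] d l -> iscell kappa [::] [:: J] p q ->
  weakly_cocartesian [:: kappa] ->
  @left_kan (V K) (comp theta [:: kappa]) (d ∘ p) q l -> vertical_lan theta J d l.
Proof.
move=> ct ck W [/= _ _ lan].
have [Jd Jl] := iscell_src ct; have [Jp Jq] := iscell_tgt ck; rewrite /= in Jl Jq.
have pd : vcod p = vdom d by congruence.
have ql : vcod q = vdom l by congruence.
have dl : vcod d = vcod l := iscell_tgt ct.
have := ck; move=> [k1 k2 k3 k4].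
have lan_comp c k : iscell c [::] [::] l k ->
    comp (odot theta c) [:: kappa] = odot (comp theta [:: kappa]) (comp c [:: idv q]).
  by move=> cc; exact: odot_comp_l ct cc ck pd isT.
have va : vcod (vsrc kappa) = vdom d by rewrite k3.
have ex k phi : iscell phi [:: J] [::] d k -> exists! c,
    iscell c [::] [::] l k /\
    comp phi [:: kappa] = odot (comp theta [:: kappa]) (comp c [:: idv q]).
  move=> cphi; have /= [_ Jk] := iscell_src cphi; apply: lan.
  - by congruence.
  - by have /= <- := iscell_tgt cphi; rewrite (vcod_comp L).
  - exact: comp1_iscell cphi ck pd.
split=> [phi k cphi|c1 c2 k cc1 cc2 e].
  have [c [[cc e] _]] := ex _ _ cphi; exists c => //; apply: (wcc_inj W _ _ va).
  - by rewrite /= k2; exact: cphi.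
  - by rewrite /= k2; exact: odot_iscell ct cc isT.
  - by rewrite (lan_comp _ _ cc).
have [c [_ U]] := ex _ _ (odot_iscell ct cc1 isT).
rewrite -(U c1) ?(U c2) //; split=> //; first by rewrite e (lan_comp _ _ cc2).
by rewrite (lan_comp _ _ cc1).
Qed.

(** * Comma objects as tabulations *)

(** Cartesianness of [theta] identifies 2-cells [j ∘ u => m ∘ v] with unary cells into [J] with
    empty source, for which [pi] is universal. *)
Lemma tabulation_comma theta J j m pi : iscell theta [:: J] [::] j m ->
  cartesian theta -> tabulation J pi ->
  @comma (V K) j m (vsrc pi) (vtgt pi) (comp theta [:: pi]).
Proof.
move=> ct Ct [[s0 t1] tab1 tab2].
have cpi : iscell pi [::] [:: J] (vsrc pi) (vtgt pi) by [].
have [Jj Jm] := iscell_src ct; have [Jp Jq] := iscell_tgt cpi; rewrite /= in Jm Jq.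
have pj : vcod (vsrc pi) = vdom j by congruence.
have qm : vcod (vtgt pi) = vdom m by congruence.
have pq : vdom (vsrc pi) = vdom (vtgt pi) := iscell_src cpi.
have tpi : composable theta [:: pi] by exact: composable1 ct cpi pj.
have whisk w : vcod w = vdom (vsrc pi) ->
    iscell (comp pi [:: idv w]) [::] [:: J] (vsrc pi ∘ w) (vtgt pi ∘ w).
  by move=> wp; exact: comp1_iscell cpi (idv_iscell w) wp.
have whiskE w : vcod w = vdom (vsrc pi) ->
    comp theta [:: comp pi [:: idv w]] = comp (comp theta [:: pi]) [:: idv w].
  by move=> wp; rewrite compA1 //; exact: composable1 cpi (idv_iscell w) wp.
split=> /= [|u v a uv uj vm ca|w w' b c wp wp' ww' cb cc e].
- by split=> //; exact: comp1_iscell ct cpi pj.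
- have [phi cphi e] := cart_ex Ct ct ca uj vm.
  have [f1 f2 f3 f4] := cphi.
  have [w [[wp ew] U]] := tab1 phi f1 f2.
  have := whisk w wp; rewrite -[comp pi _]ew => cw.
  have [_ _ g3 g4] := cw.
  exists w; split; first by split=> //; [congruence|congruence|rewrite -whiskE // e ew].
  move=> w' [wp' e1 e2 e3]; apply: U; split=> //.
  have cw' := whisk _ wp'; rewrite e1 e2 in cw'.
  apply: (cart_inj Ct ct cphi cw' uj).
  by rewrite -e -e3 whiskE.
- have cw := whisk _ wp; have cw' := whisk _ wp'.
  have pwj : vcod (vsrc pi ∘ w) = vdom j by rewrite (vcod_comp L).
  have pwm : vcod (vtgt pi ∘ w) = vdom m by rewrite (vcod_comp L) -?pq.
  have [f1 f2 f3 f4] := cw; have [g1 g2 g3 g4] := cw'.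
  (* The two-dimensional property of the tabulation, at the empty path; its compatibility condition
     follows from that on [b] and [c] by cancelling [theta]. *)
  have [|||xi [[cxi x1 x2] U]] :=
    tab2 (comp pi [:: idv w]) (comp pi [:: idv w']) w w' [::] b c f1 f2 (conj wp erefl)
      g1 g2 (conj wp' erefl).
  + by rewrite f3 g3.
  + by rewrite f4 g4.
  + apply: (cart_inj Ct ct (odot_iscell cb cw' isT) (odot_iscell cw cc isT) pwj).
    rewrite (comp_odot_r ct cb cw' pwj isT) (comp_odot_l ct cw cc pwj isT).
    by rewrite !whiskE.
  by exists xi; split=> // xi' [? ? ?]; apply: U.
Qed.

(* A comma object is isomorphic to the tabulation, so that its 2-cell inherits
   cocartesianness. *)
Lemma comma_cocartesian theta J j m p q lam : iscell theta [:: J] [::] j m ->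
  cartesian theta -> @comma (V K) j m p q lam ->
  exists kappa, [/\ iscell kappa [::] [:: J] p q, lam = comp theta [:: kappa]
                  & weakly_cocartesian [:: kappa]].
Proof.
move=> ct Ct com.
have [pi [tab [W _]]] := tabs J; have com' := tabulation_comma ct Ct tab.
have [[/= pq pj qm clam] com1 com2] := com.
have [[/= pq' pj' qm' clam'] com1' _] := com'.
have [[s0 t1] _ _] := tab.
have cpi : iscell pi [::] [:: J] (vsrc pi) (vtgt pi) by [].
have [w [[wp e1 e2 e3] _]] := com1 _ _ _ pq' pj' qm' clam'.
have [w' [[wp' e1' e2' e3'] _]] := com1' _ _ _ pq pj qm clam.
have [kappa ck ek] := cart_ex Ct ct clam pj qm.
rewrite /= in wp e1 e2 e3 wp' e1' e2' e3'.
have ww : vdom w = vdom (vsrc pi) by rewrite -e1 (vdom_comp L).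
have ww' : vdom w' = vdom p by rewrite -e1' (vdom_comp L).
have wpq : vcod w = vdom q by rewrite -pq.
have wpq' : vcod w' = vdom (vtgt pi) by rewrite -pq'.
(* Both morphisms induce [lam] itself, so the universal property of the comma object identifies
   them. *)
have eid : w ∘ w' = vid (vdom p).
  have [z [_ U]] := com1 _ _ _ pq pj qm clam; rewrite /= in U.
  rewrite -(U (vid (vdom p))); first last.
    split; rewrite ?(vcod_id L) ?(vcompf1 L) ?pq ?(vcompf1 L) // -pq.
    have := comp_idr0 L; case: (clam) => f1 _ f3 _; move=> /(_ lam f1).
    by rewrite f3 (vdom_comp L).
  symmetry; apply: U; have k1 : vcod w' = vdom w by congruence.
  split; rewrite ?(vcod_comp L) ?(vcompA L) ?e1 ?e2 // -(comp_idv L) // compA1 ?e3 //.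
    by apply: (composable1 (idv_iscell w) (idv_iscell w')).
  by apply: (composable1 clam (idv_iscell w)); rewrite (vdom_comp L).
have epi : comp kappa [:: idv w] = pi.
  have cw := comp1_iscell ck (idv_iscell w) wp; rewrite e1 e2 in cw.
  apply: (cart_inj Ct ct cw cpi) => //.
  rewrite compA1; last exact: composable1 ct ck pj.
    by rewrite -ek.
  exact: composable1 ck (idv_iscell w) wp.
have ekappa : comp pi [:: idv w'] = kappa.
  rewrite -epi -compA1; first last.
  - exact: composable1 ck (idv_iscell w) wp.
  - by apply: (composable1 (idv_iscell w) (idv_iscell w')); congruence.
  rewrite (comp_idv L) ?eid; last by congruence.
  by have := comp_idr0 L; case: (ck) => f1 _ f3 _; move=> /(_ kappa f1); rewrite f3.
exists kappa; split=> //; split=> //; first by case: ck => _ f2 _ _; split=> //; exists J.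
have [k1 k2 k3 k4] := ck; move=> psi h k /=; rewrite k1 k2 k3 k4 => hp kq f1 f2 f3.
have cpsi : iscell psi [::] (htgt psi) (h ∘ p) (k ∘ q) by [].
have hpi : vcod (vsrc pi) = vdom h by congruence.
have kpi : vcod (vtgt pi) = vdom k by congruence.
have := comp1_iscell cpsi (idv_iscell w); rewrite (vdom_comp L) // => /(_ wp).
rewrite -!(vcompA L) // e1 e2 => i.
have i' : iscell (comp psi [:: idv w]) (flatten (map (@hsrc K) [:: pi])) (htgt psi)
    (h ∘ vsrc pi) (k ∘ vtgt (last pi [::])) by rewrite /= s0.
have [psi' cpsi' e] := wcc_ex W i' hpi kpi; rewrite /= t1 in cpsi'.
have hp' : vcod p = vdom h by [].
(* The factorization through [kappa] is transported from that of [comp psi [:: idv w]] through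
   [pi]. *)
exists psi'; split=> [|psi2 [cpsi2 e4]].
  split=> //; rewrite -ekappa compA1; first last.
  - by apply: (composable1 cpsi' cpi).
  - exact: (composable1 cpi (idv_iscell w')).
  rewrite -e -compA1; first last.
  - by apply: (composable1 cpsi (idv_iscell w)); rewrite (vdom_comp L).
  - by apply: (composable1 (idv_iscell w) (idv_iscell w')); congruence.
  rewrite (comp_idv L) ?eid; last by congruence.
  by have := comp_idr0 L f1; rewrite f2 (vdom_comp L).
apply: (wcc_inj W _ _ hpi); rewrite /= ?t1; [exact: cpsi'|exact: cpsi2|].
rewrite -e e4 -epi compA1 //; first exact: composable1 ck (idv_iscell w) wp.
exact: composable1 cpsi2 ck hp'.
Qed.

(** * Unital objects as those whose identity has a companion *)

Lemma idh_inverse_path A H B : hpath A H B ->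
  inverse_path A [seq (idh J, idh J) | J <- H] B.
Proof.
elim: H A => //= J H IH A [<- p]; have c := idh_cell L J.
have e : comp (idh J) [:: idh J] = idh J by apply: (comp_idl1 L); case: c.
by exists J, J, (hcod J); split; [split|exact: IH].
Qed.

Lemma inverse_path_cat A B C s1 s2 : inverse_path A s1 B -> inverse_path B s2 C ->
  @inverse_path K A (s1 ++ s2) C.
Proof.
elim: s1 A => [|p s1 IH] A /=; first by move=> ->.
move=> [J1 [J2 [D [c h]]]] h2; exists J1, J2, D; split=> //; exact: IH.
Qed.

(** A restriction along an identity is given by a horizontal cartesian cell, which is invertible. *)
Lemma left_extension_inverse A s : left_extension (vid A) s ->
  exists B ps, @inverse_path K B ps A /\ map fst ps = s.
Proof.
case=> [->|[B [Hs [J [R [cart [p c C ->]]]]]]]; first by exists A, [::].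
have cod_cat B' Hs' : hpath B' (rcons Hs' J) (vcod (vid A)) ->
    hpath B' Hs' (hdom J) /\ hcod J = A.
  elim: Hs' B' => [|J' Hs' IH] B' /=; first by rewrite (vcod_id L) => -[-> ->].
  by move=> [-> /IH[]].
have [pHs JA] := cod_cat _ _ p.
have [cart' [c' e e']] := cartesian_inverse c isT C.
exists B, ([seq (idh J, idh J) | J <- Hs] ++ [:: (cart, cart')]); split; last first.
  by rewrite map_cat -map_comp cats1.
by apply: (inverse_path_cat (idh_inverse_path pHs)); exists R, J, A.
Qed.

Lemma right_extension_inverse A s : right_extension (vid A) s ->
  exists B ps, @inverse_path K A ps B /\ map fst ps = s.
Proof.
case=> [->|[B [Hs [J [R [cart [[JA p] c C ->]]]]]]]; first by exists A, [::].
have [cart' [c' e e']] := cartesian_inverse c isT C.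
exists B, ((cart, cart') :: [seq (idh J, idh J) | J <- Hs]); split; last first.
  by rewrite /= -map_comp.
by exists R, J, (hcod J); split=> //; exact: idh_inverse_path.
Qed.

(** The cartesian cell [eps] is horizontal, hence invertible; its inverse is the unit cell, and
    flanking it by invertible cells keeps the path weakly cocartesian. *)
Lemma has_companion_unital A : has_companion (vid A) -> unital A.
Proof.
rewrite /has_companion (vcod_id L) => -[I [eps [ceps Ceps]]].
have [eta [ceta e1 e2]] := cartesian_inverse ceps isT Ceps.
have W := unit_weakly_cocartesian ceta ceps e2 e1.
exists I, eta; split=> //; have [_ _ v1 v2] := ceta.
split; first exact: (W [::] [::] A A).
split; rewrite /= ?v1 ?v2 ?(vcod_id L).
- by move=> J JA; apply: equip; rewrite (vcod_id L).
- by move=> J JA; apply: equip; rewrite (vcod_id L).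
move=> l r /left_extension_inverse[B [ls [Il <-]]] /right_extension_inverse[C [rs [Ir <-]]].
by have := W ls rs B C Il Ir; rewrite map_cat.
Qed.

(** * Pointwise Kan extensions, density and yoneda embeddings *)

Lemma yoneda_pointwise (y f g : vert K) (phi : cell K) :
  dense y -> has_companion f -> @absolute_left_lifting (V K) phi y f g ->
  @pointwise_left_kan (V K) phi y f g.
Proof.
move=> dy [J [eps cf]] lift; have [/= cphi fg _] := lift.
have [ex inj] := vertical_factor_of_lifting cf lift.
have ct := transpose_iscell cf cphi fg.
have Ct := vertical_factor_cartesian ct isT ex inj.
have dyf : vdom y = vdom f.
  by have := vertical_iscell_dom cphi; rewrite (vdom_comp L).
split=> //= m mf.
(* [R] is [f_*(id, m)]; its cell pasted with [eps] is cartesian, so tabulating [R] gives the comma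
   object of [f] and [m]. *)
have [R [cart [cc Cc cth Cth]]] := companion_restriction (u := vid (vdom f)) cf (vcod_id L _) mf.
rewrite (vcompf1 L) in cth.
split.
  have [pi [tab _]] := tabs R; exists (vsrc pi), (vtgt pi), (comp (comp eps [:: cart]) [:: pi]).
  exact: tabulation_comma cth Cth tab.
move=> p q lam com; have [kappa [ck -> W]] := comma_cocartesian cth Cth com.
have [[/= pq pf qm _] _ _] := com.
have idy : vcod (vid (vdom f)) = vdom y by rewrite (vcod_id L).
have ct' := comp1_iscell ct cc idy; have Ct' := cart_comp Ct ct Cc cc idy.
rewrite vid_compr // in ct'.
have [s1 t1 f1 g1] := ct'.
have [_ _ lan] := dy _ _ s1 t1 f1 Ct'.
have [ceps Ceps] := cf.
have vlan : vertical_lan (comp (transpose phi g eps) [:: cart]) R y (g ∘ m).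
  have ex' k psi : iscell psi [:: R] [::] y k -> exists! c, iscell c [::] [::] (g ∘ m) k /\
      psi = odot (comp (transpose phi g eps) [:: cart]) c.
    move=> [h1 h2 h3 h4]; have := lan [::] psi; rewrite s1 f1 g1 h4.
    by apply.
  split=> [psi k /ex'[c [[cc' e] _]]|c1 c2 k d1 d2 e]; first by exists c.
  have [c [_ U]] := ex' k _ (odot_iscell ct' d1 isT).
  by rewrite -(U c1) ?(U c2) //.
have := left_kan_of_vertical_lan ct' ck W vlan.
have idp : vcod p = vdom (vid (vdom f)) by rewrite (vdom_id L).
have cartk : iscell (comp cart [:: kappa]) [::] [:: J] p (m ∘ q).
  by have := comp1_iscell cc ck idp; rewrite vid_compl.
have k1 : composable cart [:: kappa] by exact: composable1 cc ck idp.
(* Associativity and [comp_transpose] bring the Kan extension cell into the form required by the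
   pointwise condition. *)
rewrite -(compA1 k1); last exact: composable1 ct cc idy.
rewrite (comp_transpose cf cphi fg cartk pf) (compA1 k1) //.
by apply: (composable1 ceps cc); rewrite (vcod_id L).
Qed.

(** A restriction of the cartesian cell [eta] along [u] is again cartesian, so its tabulation is a
    comma object of [y] and [l ∘ u]; there the pointwise condition is the vertical Kan extension
    property. *)
Lemma dense_of_pointwise (y : vert K) :
  @pointwise_left_kan (V K) (idv y) y y (vid (vcod y)) -> dense y.
Proof.
move=> [_ _ pw] J eta s1 t1 f1 Ceta; set l := vtgt eta.
have ceta : iscell eta [:: J] [::] y l by [].
apply: (vertical_lan_defines ceta) => R cart u cc Cc.
have yJ : vcod (vid (hdom J)) = vdom y.
  by have /= [<- _] := iscell_src ceta; rewrite (vcod_id L).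
have ul : vcod u = vdom l := iscell_cod ceta cc yJ.
have lu : vcod (l ∘ u) = vcod y.
  by rewrite (vcod_comp L) //; have /= <- := iscell_tgt ceta.
have ct := comp1_iscell ceta cc yJ; rewrite vid_compr in ct; last first.
  by rewrite -yJ (vcod_id L).
have Ct := cart_comp Ceta ceta Cc cc yJ.
have [pi [tab [W _]]] := tabs R.
have [_ /(_ _ _ _ (tabulation_comma ct Ct tab))] := pw _ lu.
have cpi : iscell pi [::] [:: R] (vsrc pi) (vtgt pi) by case: tab => -[].
have py : vcod (vsrc pi) = vdom y.
  by have /= [<- _] := iscell_tgt cpi; have /= [-> _] := iscell_src ct.
have lam := comp1_iscell ct cpi py.
rewrite /= (comp_idv L) // vid_compl //.
have -> : comp (idv (vid (vcod y))) [:: comp (comp eta [:: cart]) [:: pi]]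
    = comp (comp eta [:: cart]) [:: pi].
  by have := comp_idcl lam; rewrite (vcod_comp L).
rewrite (odot_idl lam).
exact: vertical_lan_of_left_kan ct cpi W.
Qed.

Lemma good_yoneda_of_structure (S : companion_yoneda_structure K) A :
  (forall J, hdom J = A ->
     exists sigma, [/\ hsrc sigma = [:: J], htgt sigma = [::], cartesian sigma
                     & has_companion (vsrc sigma)]) ->
  has_companion (vid A) -> vdom (yon S A) = A -> good_yoneda_embedding (yon S A).
Proof.
move=> cotab uA yA; set y := yon S A.
have admA : admissible S (vid A) by apply/(gys_admissible S).
have cy : has_companion y by apply/(gys_admissible S); exact: yon_admissible admA.
split; first split.
(* Density: [idv y] exhibits [y] as an absolute left lifting of itself along the identity, so the
   second axiom of a yoneda structure applies. *)
- apply: dense_of_pointwise; have := @yon_pointwise _ S y (vid (vcod y)) (idv y).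
  rewrite /= yA; apply=> //; first by apply/(gys_admissible S).
  have cid : iscell (idv y) [::] [::] y (vid (vcod y) ∘ y).
    by rewrite (vcomp1f L); exact: idv_iscell.
  split=> //=; first by rewrite (vdom_id L).
  move=> p q a py qp qy ca; rewrite vid_compl // in ca.
  have E c : iscell c [::] [::] (y ∘ p) q ->
      odot (comp (idv y) [:: idv p]) (comp (idv (vid (vcod y))) [:: c]) = c.
    move=> cc; rewrite (comp_idv L) //.
    have := comp_idcl cc; rewrite (vcod_comp L) //= => ->; exact: odot_idl cc.
  by exists a; split=> [|c [cc ->]]; rewrite E.
(* The classifying cell of [J] is the cartesian transpose of [rep_cell S f] pasted with [phi],
   through which [sigma] factors via the companion of [f]. *)
- move=> J JA; rewrite yA in JA.
  have [sigma [s1 t1 Cs cf]] := cotab J JA; set f := vsrc sigma.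
  have cs : iscell sigma [:: J] [::] f (vtgt sigma) by [].
  have fA : vdom f = A by have /= [<- _] := iscell_src cs.
  have admf : admissible S f by apply/(gys_admissible S).
  have := @rep_lifting _ S f; rewrite /= fA => /(_ admA admf) lift.
  have [/= cphi fg _] := lift; have [J' [eps cf']] := cf.
  have [ex inj] := vertical_factor_of_lifting cf' lift.
  have ct := transpose_iscell cf' cphi fg.
  have Ct := vertical_factor_cartesian ct isT ex inj.
  have [ceps Ceps] := cf'.
  have ftgt : vcod (vtgt sigma) = vcod f by have /= <- := iscell_tgt cs.
  have cs' : iscell sigma [:: J] [::] (f ∘ vid A) (vid (vcod f) ∘ vtgt sigma).
    by rewrite vid_compl // vid_compr.
  have [||phi cphi' e] := cart_ex Ceps ceps cs'; rewrite ?(vcod_id L) ?(vdom_id L) //.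
  have idf : vcod (vid A) = vdom f by rewrite (vcod_id L).
  have idy : vcod (vid A) = vdom y by rewrite (vcod_id L).
  have Cphi : cartesian phi by apply: (cart_cancel Ceps ceps cphi' idf); rewrite -e.
  exists (comp (transpose (rep_cell S f) (rep S f) eps) [:: phi]).
  have [] := comp1_iscell ct cphi' idy; rewrite vid_compr // => *; split=> //.
  exact: cart_comp Ct ct Cphi cphi' idy.
(* The restriction along [y] and [g] is obtained from the companion of [y], restricted along the
   identity and [g]. *)
- move=> g gy; have [J [eps c]] := cy.
  have [|R [cart [_ _ ct Ct]]] := companion_restriction (u := vid A) c _ gy.
    by rewrite (vcod_id L).
  by exists R, (comp eps [:: cart]); rewrite vid_compr // in ct.
Qed.

End Tabulations.

(** * The passages between the two types of structure *)

Theorem proposition5p6 (K : avdc) (K_equipment : equipment K)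
    (K_tabulations : has_cocartesian_tabulations K) :
  (forall E : yoneda_collection K,
     exists S : companion_yoneda_structure K,
       forall A : ob K, unital A -> yon S A = emb E A)
  /\
  (has_companion_cotabulations K ->
   forall S : companion_yoneda_structure K,
     exists E : yoneda_collection K,
       forall A : ob K, unital A -> emb E A = yon S A).
Proof.
have L := avdcP K; split=> [E|cotab S].
  pose lifts f (p : vert K * cell K) :=
    @absolute_left_lifting (V K) p.2 (emb E (vdom f)) f p.1.
  (* [C(f, 1)] and its 2-cell are chosen together; the pair [(f, idv f)] only witnesses that the
     type is inhabited. *)
  pose r f := epsilon (inhabits (f, idv f)) (lifts f).
  have un (A : ob K) : has_companion (vid A) -> unital A.
    exact: has_companion_unital K_equipment _.
  have rP f : has_companion (vid (vdom f)) -> has_companion f -> lifts f (r f).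
    move=> /un uA [J [eps cf]]; apply: epsilon_spec.
    have [[_ yo] _] := emb_good E uA; have yA := emb_dom E uA.
    have [|theta [s1 t1 f1 Ct]] := yo J; first by rewrite yA (companion_dom cf).
    have ct : iscell theta [:: J] [::] (emb E (vdom f)) (vtgt theta) by [].
    have [eta [ceta _ e]] := companion_unit cf.
    (* The cell [theta] classifies the companion of [f]; composing with the companion unit gives the
       2-cell, whose transpose is [theta] again and hence cartesian. *)
    exists (vtgt theta, comp theta [:: eta]); rewrite /lifts /=.
    have idy : vcod (vid (vdom f)) = vdom (emb E (vdom f)) by rewrite yA (vcod_id L).
    have cphi := comp1_iscell ct ceta idy; rewrite vid_compr // in cphi.
    apply: (lifting_of_cartesian cf cphi (iscell_cod ct ceta idy)).
    by rewrite (transpose_unit cf ceta e ct).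
  have ideal (g f : vert K) : vcod f = vdom g -> has_companion g -> has_companion (g ∘ f).
    exact: has_companion_comp K_equipment _ _.
  have yd (A : ob K) : has_companion (vid A) -> vdom (emb E A) = A by move=> /un; exact: emb_dom.
  have ya (A : ob K) : has_companion (vid A) -> has_companion (emb E A).
    move=> /un uA; have [_ good] := emb_good E uA.
    (* The companion of [emb E A] is its restriction along an identity. *)
    by apply: good; rewrite (vcod_id L).
  have pw (f g : vert K) (phi : cell K) : has_companion (vid (vdom f)) -> has_companion f ->
      @absolute_left_lifting (V K) phi (emb E (vdom f)) f g ->
      @pointwise_left_kan (V K) phi (emb E (vdom f)) f g.
    move=> /un uA cf; have [[dy _] _] := emb_good E uA.
    exact: (yoneda_pointwise K_equipment K_tabulations).
  have rd f : has_companion (vid (vdom f)) -> has_companion f -> vdom (r f).1 = vcod f.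
    by move=> uA /(rP _ uA)[].
  have rh f : has_companion (vid (vdom f)) -> has_companion f ->
      @hom2 (V K) (r f).2 (emb E (vdom f)) ((r f).1 ∘ f).
    by move=> uA /(rP _ uA)[].
  have rc f : has_companion (vid (vdom f)) -> has_companion f ->
      vcod (r f).1 = vcod (emb E (vdom f)).
    move=> uA cf; have := vertical_iscell_cod (rh f uA cf).
    by rewrite (vcod_comp L) // rd.
  pose G := @GoodYonedaStructure (V K) (@has_companion K) ideal (emb E) yd ya
    (fun f => (r f).1) (fun f => (r f).2) rd rc rh rP pw.
  by exists (@CompanionYonedaStructure K G (fun=> conj id id)).
have yd A : unital A -> vdom (yon S A) = A.
  by move=> uA; apply: (@yon_dom (V K) S); apply/(gys_admissible S)/unital_has_companion.
have yg A : unital A -> good_yoneda_embedding (yon S A).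
  move=> uA; apply: (good_yoneda_of_structure K_equipment K_tabulations) (yd A uA) => //.
    move=> J JA; rewrite -JA in uA; have [sigma [[[? ?] _ _] ? ?]] := cotab J uA.
    by exists sigma.
  exact: unital_has_companion.
by exists (YonedaCollection yd yg).
Qed.
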